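(* Let $k$ be a field. There exists a family of $2$-dimensional complete local domains $\{(R_n,\mathfrak m_n)\}_{n\in\mathbb Z_{>0}}$, containing $k$, with $\mu(\mathfrak m_n)=4$ and $\mathrm e(R_n)=2$ for all $n$. Furthermore, each $R_n$ is an isolated singularity and its associated graded ring is unmixed.
   Context: $\mu(-)$ denotes the minimal number of generators of a module. For a Noetherian local ring $(R,\mathfrak m)$ of dimension $d$, $\mathrm e(R)=\lim_{j\to\infty} d!\,\ell_R(R/\mathfrak m^j)/j^d$ is the Hilbert-Samuel multiplicity, and the associated graded ring is $\bigoplus_{i\ge0}\mathfrak m^i/\mathfrak m^{i+1}$. A local ring is an isolated singularity if its localization at every non-maximal prime ideal is regular. A Noetherian ring $G$ is unmixed if $\dim(G/\mathfrak p)=\dim(G)$ for every associated prime $\mathfrak p$ of $G$. *)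

(* Defs.v *)
From HB Require Import structures.
From mathcomp Require Import all_boot all_order all_algebra ring_quotient.
From mathcomp Require Import boolp classical_sets reals topology normedtype sequences.

Set Implicit Arguments.
Unset Strict Implicit.
Unset Printing Implicit Defensive.
Import GRing.Theory numFieldNormedType.Exports.
Local Open Scope ring_scope.
Local Open Scope classical_set_scope.

(* Submodules are [submodClosed V], so that the ideals of [R], the unit ideal
   included, are [submodClosed R^o]; [idealr R] and [prime_idealr R] are the
   proper and the prime ideals.  All of these are boolean predicates; classical
   axioms (through [`[< _ >]]) make every subset of a type such a predicate. *)

Section Span.
Context (R : pzRingType) (V : lmodType R).

Definition span (A : set V) : {pred V} := fun v =>
  `[< exists s : seq (R * V), (forall z, z \in s -> A z.2) /\
        v = \sum_(z <- s) z.1 *: z.2 >].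

Lemma span_submod_closed A : submod_closed (span A).
Proof.
split=> [|a u v /asboolP[s [sA ->]] /asboolP[t [tA ->]]]; apply/asboolP.
  by exists [::]; split=> //; rewrite big_nil.
exists ([seq (a * z.1, z.2) | z <- s] ++ t); split=> [z|].
  by rewrite mem_cat => /orP[/mapP[w ws ->]|]; [exact: sA ws|exact: tA].
rewrite big_cat big_map /= scaler_sumr; congr (_ + _).
by apply: eq_bigr => z _; rewrite scalerA.
Qed.

HB.instance Definition _ A :=
  GRing.isSubmodClosed.Build R V (span A) (span_submod_closed A).

Definition generates n (N : {pred V}) (g : 'I_n -> V) : Prop := N =i span (range g).

Definition min_gens (N : {pred V}) (n : nat) : Prop :=
  (exists g : 'I_n -> V, generates N g) /\
  forall n' (g : 'I_n' -> V), generates N g -> (n <= n')%N.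

End Span.

Definition psubset T (A B : {pred T}) : Prop :=
  {subset A <= B} /\ ~ {subset B <= A}.

Section Length.
Context (R : pzRingType) (V : lmodType R).

Definition submodule_chain (n : nat) : Prop :=
  exists N : nat -> submodClosed V,
    forall i, (i < n)%N -> psubset (N i) (N i.+1).

Definition has_length (n : nat) : Prop :=
  submodule_chain n /\ forall n', submodule_chain n' -> (n' <= n)%N.

End Length.
Arguments has_length {R} V n.

Section QuotientModule.
Context (R : pzRingType) (V : lmodType R) (N : submodClosed V).

Definition submod_pred : {pred V} := fun v => v \in N.

Lemma submod_zmod_closed : zmod_closed submod_pred.
Proof.
split=> [|u v uN vN]; first exact: (@rpred0 _ N).
by rewrite -scaleN1r; apply: (@rpredD _ N) => //; apply: (@rpredZ _ _ N).
Qed.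
HB.instance Definition _ :=
  GRing.isZmodClosed.Build V submod_pred submod_zmod_closed.

Definition quot_module := Quotient.quot submod_pred.
HB.instance Definition _ := GRing.Zmodule.on quot_module.

Definition quot_proj (v : V) : quot_module :=
  (\pi_(Quotient.quot submod_pred) v)%qT.

Definition quot_repr (x : quot_module) : V :=
  repr (x : Quotient.quot submod_pred).

Lemma quot_reprK x : quot_proj (quot_repr x) = x.
Proof. exact: reprK. Qed.

Lemma quot_projD u v : quot_proj (u + v) = quot_proj u + quot_proj v.
Proof. exact: (raddfD (\pi_(Quotient.quot submod_pred))%qT). Qed.

Lemma quot_projE u v : (quot_proj u == quot_proj v) = (u - v \in N).
Proof. by rewrite -[RHS]/(_ \in submod_pred) Quotient.idealrBE. Qed.

Definition quot_scale (a : R) (x : quot_module) : quot_module :=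
  quot_proj (a *: quot_repr x).

Lemma quot_scaleE a v : quot_scale a (quot_proj v) = quot_proj (a *: v).
Proof.
apply/eqP; rewrite quot_projE -scalerBr; apply: (@rpredZ _ _ N).
by rewrite -quot_projE quot_reprK.
Qed.

Fact quot_scalerA a b x : quot_scale a (quot_scale b x) = quot_scale (a * b) x.
Proof. by rewrite -[x]quot_reprK !quot_scaleE scalerA. Qed.
Fact quot_scale1r : left_id 1 quot_scale.
Proof. by move=> x; rewrite -[x]quot_reprK quot_scaleE scale1r. Qed.
Fact quot_scalerDr : right_distributive quot_scale +%R.
Proof.
move=> a x y; rewrite -[x]quot_reprK -[y]quot_reprK.
by rewrite -quot_projD !quot_scaleE scalerDr quot_projD.
Qed.
Fact quot_scalerDl x : {morph quot_scale^~ x : a b / a + b}.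
Proof.
by move=> a b; rewrite -[x]quot_reprK !quot_scaleE scalerDl quot_projD.
Qed.

HB.instance Definition _ := GRing.Zmodule_isLmodule.Build R quot_module
  quot_scalerA quot_scale1r quot_scalerDr quot_scalerDl.

End QuotientModule.

Section Rings.
Context (R : comNzRingType).

Definition ideal_pow (I : {pred R}) (n : nat) : submodClosed R^o :=
  span (V := R^o) [set \prod_(i < n) x i | x in [set x : 'I_n -> R | forall i, x i \in I]].

Definition noetherian : Prop :=
  forall I : submodClosed R^o, exists n (g : 'I_n -> R^o), generates I g.

Definition maximal_ideal (m : {pred R}) : Prop :=
  (exists m' : idealr R, m =i m') /\
  forall I : idealr R, {subset m <= I} -> m =i I.

Definition local_ring (m : idealr R) : Prop :=
  maximal_ideal m /\ forall m' : idealr R, maximal_ideal m' -> m' =i m.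

Definition prime_chain (n : nat) : Prop :=
  exists p : nat -> prime_idealr R,
    forall i, (i < n)%N -> psubset (p i) (p i.+1).

Definition krull_dim (d : nat) : Prop :=
  prime_chain d /\ forall n, prime_chain n -> (n <= d)%N.

Definition adic_cauchy (I : {pred R}) (u : nat -> R) : Prop :=
  forall n, exists N, forall i j, (N <= i)%N -> (N <= j)%N ->
    u i - u j \in ideal_pow I n.

Definition adic_limit (I : {pred R}) (u : nat -> R) (l : R) : Prop :=
  forall n, exists N, forall i, (N <= i)%N -> u i - l \in ideal_pow I n.

Definition adically_complete (I : {pred R}) : Prop :=
  forall u, adic_cauchy I u -> exists! l, adic_limit I u l.

Definition regular_local (m : idealr R) : Prop :=
  [/\ noetherian, local_ring m & exists2 d, krull_dim d & min_gens (V := R^o) m d].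

Definition hs_multiplicity (K : realType) (m : {pred R}) (e : K) : Prop :=
  exists d (l : nat -> nat),
    [/\ krull_dim d,
        forall j, has_length (quot_module (ideal_pow m j)) (l j) &
        (fun j => (d`! * l j)%:R / j%:R ^+ d : K) @ \oo --> e].

End Rings.
Arguments noetherian : clear implicits.
Arguments krull_dim : clear implicits.

(* [f : R -> S] exhibits [S] as the localization of [R] at [p]. *)
Definition is_localization (R S : comNzRingType) (p : prime_idealr R)
    (f : {rmorphism R -> S}) : Prop :=
  [/\ forall s, s \notin p -> exists t, f s * t = 1,
      forall x : S, exists a s, s \notin p /\ x * f s = f a &
      forall a, f a = 0 -> exists2 s, s \notin p & s * a = 0].

(* Localizations are unique up to isomorphism, so one regular model suffices. *)
Definition isolated_singularity (R : comNzRingType) : Prop :=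
  forall p : prime_idealr R, ~ maximal_ideal p ->
    exists (S : comNzRingType) (f : {rmorphism R -> S}) (n : idealr S),
      is_localization p f /\ regular_local n.

Definition associated_prime (R : comNzRingType) (p : prime_idealr R) : Prop :=
  exists x : R, forall a, (a \in p) = (a * x == 0).

(* The equality of dimensions is also meaningful when they are infinite. *)
Definition unmixed (G : comNzRingType) : Prop :=
  noetherian G /\
  forall p : prime_idealr G, associated_prime p ->
    forall d, krull_dim {ideal_quot p} d <-> krull_dim G d.

(* The associated graded ring is presented as the quotient of
   (+)_i m^i, with the multiplication of R['X], by its ideal (+)_i m^(i+1). *)
Section AssociatedGraded.
Context (R : comNzRingType) (m : idealr R).

Lemma ideal_powMl n (a x : R) : x \in ideal_pow m n -> a * x \in ideal_pow m n.
Proof. exact: (@rpredZ R R^o (ideal_pow m n) a x). Qed.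

Lemma ideal_pow_prod n (u : 'I_n -> R) :
  (forall k, u k \in m) -> \prod_(k < n) u k \in ideal_pow m n.
Proof.
move=> uP; apply/asboolP; exists [:: (1, \prod_(k < n) u k)]; split.
  by move=> z; rewrite mem_seq1 => /eqP ->; exists u.
by rewrite big_seq1 scale1r.
Qed.

Lemma ideal_powM i j (x y : R) :
  x \in ideal_pow m i -> y \in ideal_pow m j -> x * y \in ideal_pow m (i + j).
Proof.
move=> /asboolP[s [sP ->]] /asboolP[t [tP ->]].
rewrite mulr_suml big_seq.
apply: (@rpred_sum _ (ideal_pow m (i + j))) => z zs.
rewrite mulr_sumr big_seq.
apply: (@rpred_sum _ (ideal_pow m (i + j))) => w wt.
have [u uP uE] := sP _ zs; have [v vP vE] := tP _ wt.
have -> : (z.1 *: z.2) * (w.1 *: w.2) = (z.1 * w.1) * (z.2 * w.2) :> R.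
  exact: mulrACA.
apply: ideal_powMl; rewrite -uE -vE.
pose c k := match split k with inl a => u a | inr b => v b end.
suff -> : (\prod_(k < i) u k) * (\prod_(k < j) v k) = \prod_(k < i + j) c k.
  by apply: ideal_pow_prod => k; rewrite /c; case: (split k).
rewrite big_split_ord /=; congr (_ * _); apply: eq_bigr => a _; rewrite /c.
  by rewrite (unsplitK (inl a)).
by rewrite (unsplitK (inr a)).
Qed.

Lemma ideal_pow0 (x : R) : x \in ideal_pow m 0.
Proof.
rewrite -[x]mulr1; apply: ideal_powMl.
have := @ideal_pow_prod 0 (fun=> 0); rewrite big_ord0; apply.
by case.
Qed.

Lemma ideal_pow1 (x : R) : x \in ideal_pow m 1 -> x \in m.
Proof.
move=> /asboolP[s [sP ->]]; rewrite big_seq.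
apply: (@rpred_sum _ m) => z zs; apply: idealMr.
by have [u uP <-] := sP _ zs; rewrite big_ord1.
Qed.

Definition in_rees : {pred {poly R}} := fun p =>
  `[< forall i, p`_i \in ideal_pow m i >].

Lemma in_rees_subring : subring_closed in_rees.
Proof.
split=> [|p q /asboolP pP /asboolP qP|p q /asboolP pP /asboolP qP].
- apply/asboolP => -[|i]; first exact: ideal_pow0.
  by rewrite coef1; exact: (@rpred0 _ (ideal_pow m i.+1)).
- apply/asboolP => i; rewrite coefB -[q`_i]mul1r -mulNr.
  by apply: (@rpredD _ (ideal_pow m i)); [exact: pP|apply: ideal_powMl].
- apply/asboolP => i; rewrite coefM; apply: (@rpred_sum _ (ideal_pow m i)) => j _.
  by have := ideal_powM (pP j) (qP (i - j)%N); rewrite subnKC // leq_ord.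
Qed.
HB.instance Definition _ :=
  GRing.isSubringClosed.Build {poly R} in_rees in_rees_subring.

Record rees := Rees { rees_val :> {poly R}; _ : rees_val \in in_rees }.
HB.instance Definition _ := [isSub of rees for rees_val].
HB.instance Definition _ := [Choice of rees by <:].
HB.instance Definition _ := [SubChoice_isSubComNzRing of rees by <:].

Definition rees_shift : {pred rees} := fun p =>
  `[< forall i, (p : {poly R})`_i \in ideal_pow m i.+1 >].

Lemma rees_shift_idealr : idealr_closed rees_shift.
Proof.
split=> [||p q r /asboolP qP /asboolP rP].
- by apply/asboolP => i; rewrite coef0; exact: (@rpred0 _ (ideal_pow m i.+1)).
- by apply/negP => /asboolP /(_ 0); rewrite coef1 => /ideal_pow1; rewrite idealr1.
apply/asboolP => i; have /asboolP pP := valP p.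
rewrite coefD; apply: (@rpredD _ (ideal_pow m i.+1)); last exact: rP.
rewrite coefM; apply: (@rpred_sum _ (ideal_pow m i.+1)) => j _.
by have := ideal_powM (pP j) (qP (i - j)%N); rewrite addnS subnKC // leq_ord.
Qed.
HB.instance Definition _ := isIdealr.Build rees rees_shift rees_shift_idealr.

Definition assoc_graded := {ideal_quot rees_shift}.
HB.instance Definition _ := GRing.ComNzRing.on assoc_graded.

End AssociatedGraded.

(* Main.v *)
Require Import Defs.
From HB Require Import structures.
From mathcomp Require Import all_boot all_order all_algebra ring_quotient.
From mathcomp Require Import boolp classical_sets reals topology normedtype sequences.
From mathcomp Require Import zify ring.

(** The same ring [R] serves for every index: the subring of the plane
    [S = k[[x,y]]] consisting of the series in which the monomial [y] does not
    occur. It is generated, topologically, by [x], [xy], [y^2], [y^3], and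
    [S = R + k y]. The point of this ring is that its maximal ideal [m] is the
    ideal [(x, y^2) S] of the plane, so that everything about [R] away from its
    closed point, and everything asymptotic about the powers of [m], is read
    off the regular ring [S].

    Powers. For [n > 0] one has [m^n = (x, y^2)^n S] ([rmax_powP]): with [y] of
    weight 1 and [x] of weight 2, it is the set of series of order at least
    [2n]. Counting monomials, [R/m^n] has length [n(n+1) - 1]
    ([pinch_length]), hence the multiplicity is 2, and [x], [xy], [y^2], [y^3]
    form a basis of [m/m^2] ([pinch_min_gens]).

    Primes. A prime of [S] other than the maximal ideal is principal, since
    [S/xS = k[[y]]] is a discrete valuation ring and generation modulo [x] lifts
    along [x] ([plane_prime_principal]). For a prime [p] of [R] other than [m],
    the elements [f] of [S] with [m f] contained in [p] form a prime [(g)] of [S]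
    lying over [p]. Comparing generators shows that no chain of primes
    [0 < p1 < p2 < m] exists ([no_intermediate_prime]), whence dimension 2; and
    if [u] is in [m] but not in [p], the ideal [p R_p] is generated by [u g]
    ([local_principal]), so [R_p] is a field or a discrete valuation ring
    ([loc_regular]).

    Finiteness. A ring complete along [x] in which every ideal is finitely
    generated modulo [x] is Noetherian ([complete_noetherian]); this applies to
    [R] because [R/xR] is an extension of [k[[y^2,y^3]]] by a line
    ([pinch_noetherian]). The associated graded ring is a quotient of the Rees
    algebra, itself a quotient of a polynomial ring over [R], and so is
    Noetherian by the Hilbert basis theorem ([assoc_graded_noetherian]).

    Unmixedness. By the description of the powers of [m], the associated graded
    ring embeds into the dual numbers over a polynomial ring, its element of
    degree [i] being given by its coefficients of weight [2i] and [2i+1]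
    ([symbol0M], [symbol1M]). Its elements with zero even part form an ideal of
    square zero containing every associated prime ([associated_sub]). An
    associated prime is thus contained in every prime, and the quotient by it
    has the same chains of primes as the ring ([krull_dim_nil_quot]). *)

Set Implicit Arguments.
Unset Strict Implicit.
Unset Printing Implicit Defensive.
Import GRing.Theory Num.Theory numFieldNormedType.Exports.
Local Open Scope ring_scope.
Local Open Scope classical_set_scope.

(** * Formal power series *)

(** A wrapper around sequences, which already carry a pointwise ring structure. *)
Record powser (A : Type) := Powser { scoef :> nat -> A }.
HB.instance Definition _ (A : Type) := gen_eqMixin (powser A).
HB.instance Definition _ (A : Type) := gen_choiceMixin (powser A).

Lemma powserP (A : Type) (f g : powser A) : (forall n, f n = g n) <-> f = g.
Proof.
split=> [|-> //]; case: f g => f [g] /= fg; congr Powser; exact/funext.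
Qed.

Section SeriesZmod.
Variable A : zmodType.
Implicit Types f g : powser A.

Let add f g := Powser (fun n => f n + g n).
Let opp f := Powser (fun n => - f n).
Let zero : powser A := Powser (fun=> 0).

Fact powser_addA : associative add.
Proof. by move=> f g h; apply/powserP => n /=; rewrite addrA. Qed.
Fact powser_addC : commutative add.
Proof. by move=> f g; apply/powserP => n /=; rewrite addrC. Qed.
Fact powser_add0 : left_id zero add.
Proof. by move=> f; apply/powserP => n /=; rewrite add0r. Qed.
Fact powser_addN : left_inverse zero opp add.
Proof. by move=> f; apply/powserP => n /=; rewrite addNr. Qed.
HB.instance Definition _ := GRing.isZmodule.Build (powser A)
  powser_addA powser_addC powser_add0 powser_addN.

Lemma scoefD f g n : (f + g) n = f n + g n. Proof. by []. Qed.
Lemma scoefB f g n : (f - g) n = f n - g n. Proof. by []. Qed.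

End SeriesZmod.

Section SeriesRing.
Variable A : comNzRingType.
Implicit Types f g h : powser A.

Let trunc n f : {poly A} := \poly_(i < n) f i.
Let mul f g := Powser (fun n => \sum_(i < n.+1) f i * g (n - i)%N).

Let one : powser A := Powser (fun n => (n == 0)%:R).

(** A product of series agrees with the product of truncations, which reduces
   the ring axioms to those of polynomials. *)
Let mulE N f g n : (n < N)%N -> mul f g n = (trunc N f * trunc N g)`_n.
Proof.
move=> nN; rewrite coefM; apply: eq_bigr => -[i /= ni] _; rewrite !coef_poly.
by rewrite !ifT //; lia.
Qed.

Let coefM_eq (p p' q : {poly A}) n :
  (forall i, (i <= n)%N -> p`_i = p'`_i) -> (p * q)`_n = (p' * q)`_n.
Proof.
move=> pp; rewrite !coefM; apply: eq_bigr => i _; rewrite pp //.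
by rewrite -ltnS.
Qed.

Let mul3E f g h n :
  mul (mul f g) h n = (trunc n.+1 f * trunc n.+1 g * trunc n.+1 h)`_n.
Proof.
rewrite (@mulE n.+1) //; apply: coefM_eq => i ni.
by rewrite coef_poly ltnS ni (@mulE n.+1).
Qed.

Fact powser_mulC : commutative mul.
Proof. by move=> f g; apply/powserP => n; rewrite !(@mulE n.+1) // mulrC. Qed.
Fact powser_mulA : associative mul.
Proof.
move=> f g h; rewrite [LHS]powser_mulC; apply/powserP => n.
by rewrite !mul3E mulrC mulrA.
Qed.
Fact powser_mul1 : left_id one mul.
Proof.
move=> f; apply/powserP => n; rewrite (@mulE n.+1) //.
rewrite (_ : trunc _ one = 1) ?mul1r ?coef_poly ?ltnS ?leqnn//.
by apply/polyP => -[|i]; rewrite coef_poly coef1 //= if_same.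
Qed.
Fact powser_mulD : left_distributive mul +%R.
Proof.
move=> f g h; apply/powserP => n; rewrite scoefD -big_split /=.
by apply: eq_bigr => i _; rewrite mulrDl.
Qed.
Fact powser_1neq0 : one != 0.
Proof. by apply/eqP => /powserP /(_ 0) /eqP; rewrite oner_eq0. Qed.
HB.instance Definition _ := GRing.Zmodule_isComNzRing.Build (powser A)
  powser_mulA powser_mulC powser_mul1 powser_mulD powser_1neq0.

Lemma scoef1 n : (1 : powser A) n = (n == 0)%:R. Proof. by []. Qed.

Lemma scoefM f g n : (f * g) n = \sum_(i < n.+1) f i * g (n - i)%N.
Proof. by []. Qed.

Lemma scoefM0 f g : (f * g) 0 = f 0 * g 0.
Proof. by rewrite scoefM big_ord1. Qed.

Lemma scoefM1 f g : (f * g) 1 = f 0 * g 1 + f 1 * g 0.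
Proof. by rewrite scoefM big_ord_recr big_ord1. Qed.

Lemma scoefM_shift (n m r : nat) f g :
    (forall i, (i < n)%N -> f i = 0) -> (forall i, (i < m)%N -> g i = 0) ->
  (f * g) (n + m + r)%N = \sum_(i < r.+1) f (n + i)%N * g (m + (r - i))%N.
Proof.
move=> f0 g0; rewrite scoefM -(big_mkord xpredT (fun i => f i * g (n + m + r - i)%N)).
rewrite (@big_cat_nat _ _ _ n) /=; [|by []|by lia].
rewrite big_nat big1 ?add0r; last by move=> i /andP[_ /f0->]; rewrite mul0r.
rewrite (@big_cat_nat _ _ _ (n + r.+1)) /=; [|by lia|by lia].
rewrite [X in _ + X]big_nat [X in _ + X]big1 ?addr0; last first.
  by move=> i ir; rewrite g0 ?mulr0 //; lia.
rewrite -[X in \sum_(X <= _ < _) _]add0n big_addn addKn big_mkord.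
apply: eq_bigr => -[i /= ir] _; rewrite addnC; congr (f _ * g _); lia.
Qed.

Lemma scoefM_lt (n m d : nat) f g :
    (forall i, (i < n)%N -> f i = 0) -> (forall i, (i < m)%N -> g i = 0) ->
  (d < n + m)%N -> (f * g) d = 0.
Proof.
move=> f0 g0 dnm; rewrite scoefM big1 // => -[i /= id] _.
have [/f0->|ni] := ltnP i n; first by rewrite mul0r.
by rewrite g0 ?mulr0 //; lia.
Qed.

Definition smono e (a : A) : powser A := Powser (fun d => if d == e then a else 0).

Lemma smonoM e a f d :
  (smono e a * f) d = if (e <= d)%N then a * f (d - e)%N else 0.
Proof.
rewrite scoefM; case: ifP => ed; last first.
  by rewrite big1 // => -[i /= id] _; case: eqP => ?; rewrite ?mul0r //; lia.
have ed' : (e < d.+1)%N by [].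
rewrite (bigD1 (Ordinal ed')) //= eqxx big1 ?addr0 // => i /negPf.
by rewrite -val_eqE /= => ->; rewrite mul0r.
Qed.

End SeriesRing.

Lemma powser_mulf_eq0 (A : idomainType) (f g : powser A) :
  f * g = 0 -> f = 0 \/ g = 0.
Proof.
have low (h : powser A) : h <> 0 -> exists2 n, h n != 0 & forall i, (i < n)%N -> h i = 0.
  move=> h0; have ex : exists n, h n != 0.
    apply: contrapT => hn; apply: h0; apply/powserP => n; apply/eqP.
    by apply: contrapT => /negP hn0; apply: hn; exists n.
  case: (ex_minnP ex) => n hn nmin; exists n => // i.
  by apply: contraTeq => /nmin; rewrite leqNgt.
move=> fg; have [->|/low[n fn fi]] := pselect (f = 0); first by left.
have [->|/low[m gm gi]] := pselect (g = 0); first by right.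
have := scoefM_shift 0 fi gi; rewrite fg big_ord1 !addn0 => /esym /eqP.
by rewrite mulf_eq0 (negPf fn) (negPf gm).
Qed.

(** [s n] plays the role of the infinite sum of the [x^j r_(n+j)]; asking only
    for the recursion that characterizes it avoids any topology. *)
Definition complete_along (R : pzRingType) (x : R) : Prop :=
  forall r : nat -> R, exists s : nat -> R, forall n, s n = r n + x * s n.+1.

(** Such a sequence has all its terms divisible by every power of [x]. *)
Definition separated_along (R : pzRingType) (x : R) : Prop :=
  forall s : nat -> R, (forall n, s n = x * s n.+1) -> s 0 = 0.

Section SeriesComplete.
Variables (A : comNzRingType) (e : nat) (a : A).
Hypothesis e_gt0 : (0 < e)%N.

(** A coefficient of the sum of the [(a s^e)^j r_(n+j)] only involves finitely
    many terms, so any graded condition [P] stable under sums and under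
    multiplication by [a s^e] passes to the sum. *)
Lemma smono_complete (P : nat -> A -> Prop) (r : nat -> powser A) :
    (forall d p q, P d p -> P d q -> P d (p + q)) ->
    (forall d p, P d p -> P (d + e)%N (a * p)) -> (forall n d, P d (r n d)) ->
  exists s : nat -> powser A, (forall n d, P d (s n d)) /\
    forall n, s n = r n + smono e a * s n.+1.
Proof.
move=> PD PM Pr.
(* [t fuel n d] is the coefficient of degree [d] of [s n]; any fuel at least
   [d] gives the same value since [e > 0]. *)
pose t := fix t (fuel n d : nat) {struct fuel} : A := r n d + (if fuel is fuel'.+1 then
  if (e <= d)%N then a * t fuel' n.+1 (d - e)%N else 0 else 0).
have tE fuel n d : (d <= fuel)%N -> t fuel n d = t d n d.
  elim/ltn_ind: d fuel n => d IH [|fuel] n; first by rewrite leqn0 => /eqP->.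
  case: d IH => [_ _|d IH df] /=; first by rewrite leqn0 (gtn_eqF e_gt0).
  by case: ifP => ed //; rewrite !IH //; lia.
exists (fun n => Powser (fun d => t d n d)); split=> [n d /=|n].
  have : P d (t d n d); last by [].
  move: {2}d => fuel; elim: fuel n d => [|fuel IH] n d /=.
    by rewrite addr0.
  case: ifP => ed; last by rewrite addr0.
  by apply: (PD) => //; rewrite -[X in P X _](subnK ed); apply: PM.
apply/powserP => d; rewrite scoefD smonoM.
case: d => [|d] /=; first by rewrite leqn0 (gtn_eqF e_gt0).
by case: ifP => ed //; rewrite tE //; lia.
Qed.

Lemma smono_separated : separated_along (smono e a).
Proof.
move=> s sE; apply/powserP => d; suff H n : s n d = 0 by exact: H.
elim/ltn_ind: d n => d IH n; rewrite sE smonoM; case: ifP => // ed.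
by rewrite IH ?mulr0 //; lia.
Qed.

End SeriesComplete.

(** The inverse is a geometric series: with [f = c (1 - s h)], summing the
    powers of [h] along the variable [s] solves [g = 1 + s h g]. *)
Lemma powser_inv (A : comNzRingType) (f : powser A) (c : A) :
  c * f 0 = 1 -> exists g, f * g = 1.
Proof.
move=> cf; pose h := Powser (fun n => - (c * f n.+1)).
pose X : powser A := smono 1 1.
have fE : smono 0 c * f = 1 - X * h.
  apply/powserP => -[|n]; rewrite scoefB !smonoM scoef1 //=.
    by rewrite subr0.
  by rewrite mul1r opprK subn1 /= add0r.
have [s [_ sE]] := @smono_complete A 1 1 (ltn0Sn _) (fun _ _ => True)
  (fun n => h ^+ n) (fun _ _ _ _ _ => I) (fun _ _ _ => I) (fun _ _ => I).
have s1 n : s n.+1 - h * s n = 0.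
  have := @smono_separated A 1 1 (ltn0Sn _) (fun i => s (n + i).+1 - h * s (n + i)%N).
  rewrite addn0; apply=> i; rewrite [s (n + i).+1]sE [s (n + i)%N]sE exprS addnS.
  by rewrite -/X; ring.
exists (smono 0 c * s 0).
have s1E : s 1 = h * s 0 by apply/subr0_eq/s1.
rewrite mulrCA mulrA fE mulrBl mul1r -mulrA -s1E [s 0]sE expr0 -/X.
by rewrite addrK.
Qed.

(** Over an [x]-adically complete and separated ring, congruences modulo [x]
    lift: if elements [f n] of a family are expressed in a finite sequence [g]
    up to [x] times the next one, then [f 0] is in the ideal generated by [g]. *)
Lemma complete_lift (R : comNzRingType) (x : R) I (s : seq I) (g : I -> R)
    (f : nat -> R) (c : nat -> I -> R) :
    complete_along x -> separated_along x ->
    (forall n, f n = \sum_(i <- s) c n i * g i + x * f n.+1) ->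
  exists a : I -> R, f 0 = \sum_(i <- s) a i * g i.
Proof.
move=> cx sx fE.
have /choice[a aE] i := cx (c^~ i).
exists (fun i => a i 0); apply/eqP; rewrite -subr_eq0; apply/eqP.
apply: (sx (fun n => f n - \sum_(i <- s) a i n * g i)) => n.
rewrite {1}fE mulrBr mulr_sumr addrAC [RHS]addrC; congr (_ + _); rewrite -sumrB -sumrN.
by apply: eq_bigr => i _; rewrite (aE i n) mulrDl opprD addrA subrr add0r mulrA.
Qed.

(** * Ideals, spans and adically complete rings *)

Notation ispan A := (@Defs.span _ _^o A).

Section Ideals.
Variable R : comNzRingType.
Implicit Types (A B : set R) (I : submodClosed R^o).

Definition submod_of (V : lmodType R) (P : {pred V}) (H : submod_closed P) :
    submodClosed V :=
  HB.pack P (GRing.isSubmodClosed.Build R V P H).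

Lemma ideal0 I : (0 : R) \in I. Proof. exact: (@rpred0 _ I). Qed.
Lemma idealD I (f g : R) : f \in I -> g \in I -> f + g \in I.
Proof. exact: (@rpredD _ I). Qed.
Lemma idealB I (f g : R) : f \in I -> g \in I -> f - g \in I.
Proof. by move=> fI gI; rewrite -mulN1r; apply: idealD => //; apply: (@rpredZ _ _ I). Qed.
Lemma idealM I (a f : R) : f \in I -> a * f \in I.
Proof. exact: (@rpredZ _ R^o I). Qed.

Lemma mem_span A (a : R) : A a -> a \in ispan A.
Proof.
move=> Aa; apply/asboolP; exists [:: (1, a)]; split=> [z|].
  by rewrite mem_seq1 => /eqP ->.
by rewrite big_seq1 scale1r.
Qed.

Lemma span_sub A I : (forall a, A a -> a \in I) -> {subset ispan A <= I}.
Proof.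
move=> AI f /asboolP[s [sA ->]]; rewrite big_seq.
by apply: (@rpred_sum _ I) => z zs; apply: (@rpredZ _ _ I); exact/AI/sA.
Qed.

Lemma span_mono A B : (forall a, A a -> B a) ->
  {subset ispan A <= ispan B}.
Proof. by move=> AB; apply: span_sub => a /AB /mem_span. Qed.

Lemma span_rangeP n (g : 'I_n -> R) (f : R) :
  f \in ispan (range g) <-> exists a : 'I_n -> R, f = \sum_i a i * g i.
Proof.
split=> [/asboolP[s [sg ->]]|[a ->]]; last first.
  apply: (@rpred_sum _ (Defs.span _)) => i _; apply: (idealM (I := Defs.span _)).
  by apply: mem_span; exists i.
elim: s sg => [|z s IH] sg.
  by exists (fun=> 0); rewrite big_nil big1 // => i _; rewrite mul0r.
have [a aE] := IH (fun w ws => sg w (mem_behead (s := z :: s) ws)).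
have [i _ iz] := sg z (mem_head z s).
exists (fun j => a j + (j == i)%:R * z.1); rewrite big_cons aE addrC.
under [RHS]eq_bigr do rewrite mulrDl.
rewrite big_split /=; congr (_ + _); rewrite (bigD1 i) //= big1 ?addr0.
  by rewrite eqxx mul1r iz.
by move=> j /negPf ->; rewrite !mul0r.
Qed.

Lemma range_tnth (s : seq R) : range (tnth (in_tuple s)) = [set` s].
Proof.
apply/seteqP; split=> [a [i _ <-] /=|a /= /(nthP 0)[i si <-]]; first exact: mem_tnth.
by exists (Ordinal si) => //; rewrite (tnth_nth 0).
Qed.

Definition fin_gen (I : {pred R^o}) : Prop :=
  exists n (g : 'I_n -> R^o), generates I g.

Lemma fin_genP I : fin_gen I <-> exists s : seq R,
  {subset s <= I} /\ {subset I <= ispan [set` s]}.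
Proof.
split=> [[n [g gI]]|[s [sI Is]]].
  exists (codom g); split=> [a /codomP[i ->]|a].
    by rewrite gI; apply: mem_span; exists i.
  rewrite gI; apply: span_mono => _ [i _ <-]; exact: codom_f.
exists (size s), (tnth (in_tuple s)) => f; rewrite range_tnth; apply/idP/idP.
  exact: Is.
by apply: span_sub => a /sI.
Qed.

(** The elements [h] produced by the hypothesis, chosen one after the other
    starting from [f], form a family to which [complete_lift] applies. *)
Lemma complete_lift_span (x : R) (Q : R -> Prop) (s : seq R) :
    complete_along x -> separated_along x ->
    (forall f, Q f -> exists c h,
       [/\ c \in ispan [set` s], Q h & f = c + x * h]) ->
  forall f, Q f -> f \in ispan [set` s].
Proof.
move=> cx sx H f Qf; rewrite -range_tnth in H *.
have /choice[F FE] (u : {f | Q f}) : exists v : ('I_(size s) -> R) * {h | Q h},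
    sval u = \sum_i v.1 i * tnth (in_tuple s) i + x * sval v.2.
  have [c [h [/span_rangeP[a ->] Qh ->]]] := H _ (svalP u).
  by exists (a, exist _ h Qh).
pose u n := iter n (fun u => (F u).2) (exist _ f Qf).
apply/span_rangeP.
have := @complete_lift R x _ (index_enum 'I_(size s)) (tnth (in_tuple s))
  (fun n => sval (u n)) (fun n => (F (u n)).1) cx sx.
by apply=> n; rewrite [LHS]FE.
Qed.

End Ideals.

Definition prime_of (R : nzRingType) (P : {pred R}) (H : idealr_closed P)
    (H' : prime_idealr_closed P) : prime_idealr R :=
  HB.pack P (isIdealr.Build R P H) (isPrimeIdealrClosed.Build R P H').

Section ZeroIdeal.
Variable R : nzRingType.

Definition zero_ideal : {pred R} := pred1 0.

Lemma zero_idealE r : (r \in zero_ideal) = (r == 0). Proof. by []. Qed.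

Lemma zero_idealr : idealr_closed zero_ideal.
Proof.
split=> [||a u v /eqP-> /eqP->]; rewrite !zero_idealE ?mulr0 ?addr0 //.
exact: oner_neq0.
Qed.

Lemma zero_prime : (forall u v : R, u * v = 0 -> u = 0 \/ v = 0) ->
  prime_idealr_closed zero_ideal.
Proof. by move=> dom u v /eqP/dom[] ->; apply/orP; [left|right]; apply/eqP. Qed.
End ZeroIdeal.

Section CompleteNoetherian.
Variables (R : comNzRingType) (x : R).
Hypotheses (cx : complete_along x) (sx : separated_along x).
Hypothesis fin_mod_x : forall I : submodClosed R^o, exists s : seq R,
  {subset s <= I} /\ forall f, f \in I ->
    exists c h, c \in ispan [set` s] /\ f = c + x * h.
Variable I : submodClosed R^o.

Let colon n : {pred R^o} := fun f => x ^+ n * f \in I.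
Let sat : {pred R^o} := fun f => `[< exists n, f \in colon n >].

Let colonE n f : (f \in colon n) = (x ^+ n * f \in I). Proof. by []. Qed.

Let colon_closed n : submod_closed (colon n).
Proof.
split=> [|a u v]; rewrite !colonE; first by rewrite mulr0 (@rpred0 _ I).
move=> uI vI; rewrite mulrDr; apply: idealD => //.
by rewrite mulrCA; apply: idealM.
Qed.
Let J n := submod_of (colon_closed n).

Let JE n f : (f \in J n) = (x ^+ n * f \in I). Proof. by []. Qed.

Let colonS n m f : (n <= m)%N -> f \in J n -> f \in J m.
Proof.
move=> nm; rewrite !JE => fI.
by rewrite -(subnK nm) exprD -mulrA; apply: idealM.
Qed.

Let sat_closed : submod_closed sat.
Proof.
split=> [|a u v]; first by apply/asboolP; exists 0; apply: (@rpred0 _ (J 0)).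
move=> /asboolP[n un] /asboolP[m vm]; apply/asboolP; exists (n + m)%N.
apply: (@idealD _ (J (n + m))); last by apply: colonS vm; lia.
by apply: (@idealM _ (J (n + m))); apply: colonS un; lia.
Qed.
Let Jsat := submod_of sat_closed.

Let fg_sat : exists s : seq R, {subset s <= Jsat} /\
  {subset Jsat <= ispan [set` s]}.
Proof.
have [s [sJ sE]] := fin_mod_x Jsat.
exists s; split=> //; apply: (complete_lift_span cx sx) => f fJ.
have [c [h [cs fE]]] := sE f fJ; exists c, h; split=> //.
have : x * h \in Jsat.
  rewrite (_ : x * h = f - c); last by rewrite fE addrC addKr.
  by apply: idealB => //; apply: span_sub cs => a /sJ.
move=> /asboolP[n]; rewrite colonE mulrA -exprSr => hI.
by apply/asboolP; exists n.+1.
Qed.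

Let fg_step n : fin_gen (J n.+1) -> fin_gen (J n).
Proof.
move=> /fin_genP[t [tJ Jt]]; have [s [sJ sE]] := fin_mod_x (J n).
have xJ h : (x * h \in J n) = (h \in J n.+1).
  by rewrite !JE mulrA -exprSr.
apply/fin_genP; exists (s ++ [seq x * b | b <- t]); split=> [a|f fJ].
  rewrite mem_cat => /orP[/sJ//|/mapP[b /tJ bJ ->]].
  by rewrite xJ.
have [c [h [cs fE]]] := sE f fJ; rewrite fE; apply: (idealD (I := Defs.span _)).
  by apply: span_mono cs => a /= as_; rewrite mem_cat as_.
have hJ : h \in J n.+1.
  rewrite -xJ (_ : x * h = f - c); last by rewrite fE addrC addKr.
  by apply: idealB => //; apply: span_sub cs => a /sJ.
have : h \in ispan [set` t] by exact: Jt.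
move=> /asboolP[r [rt ->]]; rewrite mulr_sumr big_seq.
apply: (@rpred_sum _ (Defs.span _)) => z zr; rewrite mulrCA.
apply: (idealM (I := Defs.span _)); apply: mem_span => /=.
by rewrite mem_cat orbC map_f //; exact: rt.
Qed.

(** If [R] is [x]-adically complete and every ideal is finitely generated
    modulo [x], then the saturation of [I] by the powers of [x] is finitely
    generated by lifting, it equals [I : x^N] for some [N], and finite
    generation descends from [I : x^(n+1)] to [I : x^n]. *)
Lemma complete_fin_gen : fin_gen I.
Proof.
have [s [sJ Js]] := fg_sat.
have [N sN] : exists N, {subset s <= J N}.
  have : {subset s <= Jsat} by [].
  elim: s {sJ Js} => [|a s IH] sJ; first by exists 0%N.
  have /asboolP[n an] := sJ _ (mem_head a s).
  have [m sm] := IH (fun b bs => sJ b (mem_behead (s := a :: s) bs)).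
  exists (n + m)%N => b; rewrite inE => /orP[/eqP->|/sm].
    by apply: colonS an; lia.
  by apply: colonS; lia.
have : fin_gen (J N).
  apply/fin_genP; exists s; split=> // f fJ; apply: Js; apply/asboolP.
  by exists N.
have -> : fin_gen I = fin_gen (J 0).
  by congr fin_gen; apply/funext => f; rewrite /= /colon expr0 mul1r.
by elim: N {sN} => // N IH /fg_step.
Qed.

End CompleteNoetherian.

Lemma complete_noetherian (R : comNzRingType) (x : R) :
    complete_along x -> separated_along x ->
    (forall I : submodClosed R^o, exists s : seq R,
      {subset s <= I} /\ forall f, f \in I ->
        exists c h, c \in ispan [set` s] /\ f = c + x * h) ->
  noetherian R.
Proof. by move=> cx sx H I; apply: (complete_fin_gen cx sx H). Qed.

(** * The plane and the pinched plane *)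

(** Degrees [i] and [j] add up while the bounds on sizes (degrees in [u]) grow
    like half of them. *)
Lemma weight_add a b i j d : (a <= i./2.+1 -> b <= j./2.+1 -> i + j <= d ->
  (a + b).-1 <= d./2.+1)%N.
Proof. lia. Qed.

Section Rings.
Variable k : fieldType.
Notation T := (powser {poly k}).
Implicit Type p : {poly k}.

(** The ring [k[[x,y]]] is realized inside [k[u][[s]]] by [y = s], [x = u s^2]:
    the coefficient of [s^d] is a polynomial in [u] of degree at most [d/2].
    The order in [s] is then the weight giving [y] degree 1 and [x] degree 2,
    for which the powers of the maximal ideal of [pinch] are the sets of series
    of order at least an even integer. *)
Definition weighted : {pred T} := fun F => `[< forall d, (size (F d) <= d./2.+1)%N >].

Lemma weighted_subring : subring_closed weighted.
Proof.
split=> [|F G /asboolP FP /asboolP GP|F G /asboolP FP /asboolP GP]; apply/asboolP.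
- move=> d; rewrite scoef1; case: eqP => _; last by rewrite size_poly0.
  by rewrite size_poly1.
- move=> d; rewrite scoefB (leq_trans (size_polyD _ _)) // size_polyN geq_max.
  by rewrite FP GP.
- move=> d; rewrite scoefM (leq_trans (size_sum _ _ _)) //; apply/bigmax_leqP => -[i /= id] _.
  rewrite (leq_trans (size_polyMleq _ _)) //.
  by apply: (weight_add (FP i) (GP (d - i)%N)); lia.
Qed.
HB.instance Definition _ := GRing.isSubringClosed.Build T weighted weighted_subring.

Record plane := Plane { plane_val :> T; _ : plane_val \in weighted }.
HB.instance Definition _ := [isSub of plane for plane_val].
HB.instance Definition _ := [Choice of plane by <:].
HB.instance Definition _ := [SubChoice_isSubComNzRing of plane by <:].

Lemma plane_size (f : plane) d : (size (f d) <= d./2.+1)%N.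
Proof. by have /asboolP := valP f. Qed.

Lemma plane_inj : injective plane_val. Proof. exact: val_inj. Qed.
Lemma planeDE (f g : plane) : plane_val (f + g) = plane_val f + plane_val g.
Proof. by []. Qed.
Lemma planeP (f g : plane) : (forall d, f d = g d) -> f = g.
Proof. by move=> fg; apply/val_inj/powserP. Qed.
Lemma planeD (f g : plane) d : (f + g) d = f d + g d. Proof. by []. Qed.
Lemma planeB (f g : plane) d : (f - g) d = f d - g d. Proof. by []. Qed.
Lemma plane0 d : (0 : plane) d = 0. Proof. by []. Qed.
Lemma planeM (f g : plane) : plane_val (f * g) = plane_val f * plane_val g.
Proof. by []. Qed.

Lemma plane_mulf_eq0 (f g : plane) : f * g = 0 -> f = 0 \/ g = 0.
Proof.
move=> /(congr1 plane_val); rewrite planeM => fg.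
by case: (powser_mulf_eq0 fg) => /(@val_inj _ _ _ _ 0) ->; [left|right].
Qed.

(** The coefficient of [s] is the constant which multiplies [y]. *)
Definition flat : {pred plane} := fun f => f 1 == 0.

Lemma flat_subring : subring_closed flat.
Proof.
split=> [|f g /eqP f1 /eqP g1|f g /eqP f1 /eqP g1]; apply/eqP.
- by [].
- by rewrite planeB f1 g1 subr0.
- by rewrite planeM scoefM1 f1 g1 mulr0 mul0r addr0.
Qed.
HB.instance Definition _ := GRing.isSubringClosed.Build plane flat flat_subring.

(** The ring of the theorem: series in [x] and [y] without the monomial [y]. *)
Record pinch := Pinch { pinch_val :> plane; _ : pinch_val \in flat }.
HB.instance Definition _ := [isSub of pinch for pinch_val].
HB.instance Definition _ := [Choice of pinch by <:].
HB.instance Definition _ := [SubChoice_isSubComNzRing of pinch by <:].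

Lemma pinch_coef1 (f : pinch) : f 1 = 0.
Proof. exact/eqP/(valP f). Qed.

Lemma pinch_inj : injective pinch_val. Proof. exact: val_inj. Qed.
Lemma pinchM (f g : pinch) : pinch_val (f * g) = pinch_val f * pinch_val g.
Proof. by []. Qed.
Lemma pinchD (f g : pinch) : pinch_val (f + g) = pinch_val f + pinch_val g.
Proof. by []. Qed.
Lemma pinchB (f g : pinch) : pinch_val (f - g) = pinch_val f - pinch_val g.
Proof. by []. Qed.

Lemma pinch_of (f : plane) : f 1 = 0 -> exists g : pinch, pinch_val g = f.
Proof. by move=> /eqP f1; exists (Pinch f1). Qed.

Lemma plane_of (F : T) : (forall d, (size (F d) <= d./2.+1)%N) ->
  exists f : plane, plane_val f = F.
Proof. by move=> FP; exists (Plane (introT (asboolP _) FP)). Qed.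

Definition plane_mono e p : plane := insubd 0 (smono e p).
Definition pinch_mono e p : pinch := insubd 0 (plane_mono e p).

Lemma plane_monoE e p : (size p <= e./2.+1)%N ->
  plane_val (plane_mono e p) = smono e p.
Proof.
move=> sp; apply: (insubdK 0); apply/asboolP => d /=.
by case: eqP => [->|_]; rewrite ?size_poly0.
Qed.

Lemma pinch_monoE e p : (size p <= e./2.+1)%N -> e != 1 ->
  plane_val (pinch_val (pinch_mono e p)) = smono e p.
Proof.
move=> sp e1; rewrite -plane_monoE //; congr plane_val.
by apply: (insubdK 0); apply/eqP; rewrite plane_monoE //= eq_sym (negPf e1).
Qed.

Definition px : plane := plane_mono 2 'X.
Definition rx : pinch := pinch_mono 2 'X.

Lemma pxE : plane_val px = smono 2 'X. Proof. by rewrite plane_monoE ?size_polyX. Qed.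
Lemma rxE : pinch_val rx = px.
Proof. by apply: val_inj; rewrite /= pinch_monoE ?size_polyX // pxE. Qed.

Lemma px_coef (f : plane) d : (px * f) d = if (2 <= d)%N then 'X * f (d - 2)%N else 0.
Proof. by rewrite planeM pxE smonoM. Qed.

Lemma px_separated : separated_along px.
Proof.
move=> s sE; apply: val_inj; apply: (@smono_separated _ 2 'X _ (val \o s)) => // n.
by rewrite /= [in LHS]sE planeM pxE.
Qed.

Let size_mulX d (p : {poly k}) :
  (size p <= d./2.+1)%N -> (size ('X * p)%R <= (d + 2)./2.+1)%N.
Proof. by move=> sp; rewrite (leq_trans (size_polyMleq _ _)) // size_polyX; lia. Qed.

Lemma px_complete : complete_along px.
Proof.
move=> r; have [] := @smono_complete _ 2 'X (ltn0Sn _)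
  (fun d p => size p <= d./2.+1)%N (fun n => r n).
- by move=> d p q Hp Hq; rewrite (leq_trans (size_polyD _ _)) // geq_max Hp.
- exact: size_mulX.
- by move=> n d; exact: plane_size.
move=> s [sP sE].
have /choice[t tE] n := plane_of (sP n).
by exists t => n; apply: plane_inj; rewrite planeDE planeM !tE sE pxE.
Qed.

Lemma rx_separated : separated_along rx.
Proof.
move=> s sE; apply: pinch_inj; apply: (px_separated (s := fun n => s n)) => n.
by rewrite {1}sE pinchM rxE.
Qed.

Lemma rx_complete : complete_along rx.
Proof.
move=> r; have [s sE] := px_complete (fun n => r n).
have s1 n : s n 1 = 0 by rewrite sE planeD px_coef pinch_coef1 addr0.
have /choice[t tE] n := pinch_of (s1 n).
by exists t => n; apply: pinch_inj; rewrite pinchD pinchM !tE rxE sE.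
Qed.

(** The inverse taken in [k[u][[s]]] satisfies the degree bounds, by induction
    on the degree. *)
Lemma plane_inv (f : plane) : (f 0)`_0 != 0 -> exists g : plane, f * g = 1.
Proof.
move=> f0; have f0E : f 0 = ((f 0)`_0)%:P by apply: size1_polyC; exact: (plane_size f 0).
have [|g fg] := @powser_inv _ (plane_val f) (((f 0)`_0)^-1%:P).
  by rewrite {2}f0E -polyCM mulVf.
suff /plane_of[h hE] : forall d, (size (g d) <= d./2.+1)%N.
  by exists h; apply: plane_inj; rewrite planeM hE fg.
elim/ltn_ind => d IH.
have : (plane_val f * g) d = (d == 0)%:R by rewrite fg.
rewrite scoefM big_ord_recl subn0 f0E => /(canRL (addrK _)) gE.
rewrite -(@size_Cmul _ (f 0)`_0) // gE (leq_trans (size_polyD _ _)) // geq_max.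
apply/andP; split; first by case: eqP; rewrite ?size_poly1 ?size_poly0.
rewrite size_polyN (leq_trans (size_sum _ _ _)) //; apply/bigmax_leqP => -[i /= id] _.
rewrite /bump /= add1n (leq_trans (size_polyMleq _ _)) //.
by apply: (weight_add (plane_size f i.+1) (IH (d - i.+1)%N _)); lia.
Qed.

Lemma pinch_inv (f : pinch) : (f 0)`_0 != 0 -> exists g : pinch, f * g = 1.
Proof.
move=> f0; have [g fg] := plane_inv f0.
have /pinch_of[h hE] : g 1 = 0.
  have : (plane_val f * plane_val g) 1 = 0 by rewrite -planeM fg.
  rewrite scoefM1 pinch_coef1 mul0r addr0 => /eqP; rewrite mulf_eq0 => /orP[]/eqP//.
  by move=> f00; rewrite f00 coef0 eqxx in f0.
by exists h; apply: pinch_inj; rewrite pinchM hE fg.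
Qed.
End Rings.

(** * Primes of the plane *)

Section Domain.
Variable k : fieldType.
Implicit Types (f g h : plane k).
Notation px := (px k).

(** Inverses are chosen non-constructively, in order to obtain the structure of
    an integral domain. *)
Definition pinch_unit : {pred pinch k} := fun a => `[< exists b, b * a = 1 >].
Definition pinch_invr (a : pinch k) : pinch k :=
  if pselect (exists b, b * a = 1) is left ex then projT1 (cid ex) else a.

Fact pinch_mulVr : {in pinch_unit, left_inverse 1 pinch_invr *%R}.
Proof.
move=> a /asboolP ex; rewrite /pinch_invr; case: pselect => // ex'.
by case: cid.
Qed.
Fact pinch_unitP a b : b * a = 1 -> a \in pinch_unit.
Proof. by move=> ba; apply/asboolP; exists b. Qed.
Fact pinch_inv_out : {in [predC pinch_unit], pinch_invr =1 id}.
Proof.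
by move=> a /asboolPn na; rewrite /pinch_invr; case: pselect.
Qed.
HB.instance Definition _ := GRing.ComNzRing_hasMulInverse.Build (pinch k)
  pinch_mulVr pinch_unitP pinch_inv_out.

Fact pinch_integral : GRing.integral_domain_axiom (pinch k).
Proof.
move=> a b ab; have /plane_mulf_eq0[] : pinch_val a * pinch_val b = 0 by rewrite -pinchM ab.
  by move=> /(@pinch_inj _ _ 0) ->; rewrite eqxx.
by move=> /(@pinch_inj _ _ 0) ->; rewrite eqxx orbT.
Qed.
HB.instance Definition _ :=
  GRing.ComUnitRing_isIntegral.Build (pinch k) pinch_integral.

(** Divisibility by [x = u s^2] is divisibility by [u] of every coefficient. *)
Lemma px_div f : (forall d, (f d)`_0 = 0) -> exists h, f = px * h.
Proof.
move=> f0; have [h hE] : exists h : plane k,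
    plane_val h = Powser (fun d => drop_poly 1 (f (d + 2)%N)).
  apply: plane_of => d /=; rewrite size_drop_poly.
  by have := plane_size f (d + 2)%N; rewrite addn2 /= => H; rewrite leq_subLR add1n.
exists h; apply: planeP => d; rewrite px_coef hE /=.
have fE e : f e = 'X * drop_poly 1 (f e).
  by apply/polyP => -[|i]; rewrite coefXM /= ?f0 // coef_drop_poly addn1.
case: ifP => d2; first by rewrite subnK.
rewrite [LHS]fE drop_poly_eq0 ?mulr0 // (leq_trans (plane_size f d)) //.
by case: d d2 => [|[]].
Qed.

Definition py d : plane k := plane_mono d 1.

Lemma pyE d : plane_val (py d) = smono d 1.
Proof. by rewrite plane_monoE // size_poly1. Qed.

Lemma py_coef d f e : (py d * f) e = if (d <= e)%N then f (e - d)%N else 0.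
Proof. by rewrite planeM pyE smonoM mul1r. Qed.

(** The cofactor [w] of [y^d] is a series in [y] alone, read off [f] at [x = 0]. *)
Lemma plane_split f d : (forall e, (e < d)%N -> (f e)`_0 = 0) ->
  exists w h, f = py d * w + px * h /\ forall e, (w e)`_0 = (f (d + e)%N)`_0.
Proof.
move=> f0; have [w wE] : exists w : plane k,
    plane_val w = Powser (fun e => ((f (d + e)%N)`_0)%:P).
  by apply: plane_of => e /=; rewrite (leq_trans (size_polyC_leq1 _)).
have [|h hE] := @px_div (f - py d * w).
  move=> e; rewrite planeB coefB py_coef wE /=; case: ltnP => de.
    by rewrite f0 // coef0 subr0.
  by rewrite coefC eqxx subnKC // subrr.
by exists w, h; split=> [|e]; rewrite -?hE ?wE ?coefC // addrC subrK.
Qed.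

Lemma py_expr d : py d.+1 = py 1 ^+ d.+1.
Proof.
elim: d => // d IH; rewrite exprS -IH; apply: planeP => e.
rewrite py_coef !pyE /=; case: e => [|e] //=.
by rewrite subn1 eqSS.
Qed.

Section PrimePrincipal.
Variable Q : plane k -> Prop.
Hypotheses (Q0 : Q 0) (QB : forall f g, Q f -> Q g -> Q (f - g))
  (QM : forall f g, Q g -> Q (f * g))
  (Qprime : forall f g, Q (f * g) -> Q f \/ Q g)
  (Qmax : exists2 t : plane k, (t 0)`_0 = 0 & ~ Q t).

Let QD f g : Q f -> Q g -> Q (f + g).
Proof. by move=> Qf Qg; rewrite -[g]opprK -[- g]sub0r; apply/QB/QB. Qed.

Let Q1 : ~ Q 1.
Proof. by case: Qmax => t _ Qt Q1; apply: Qt; rewrite -[t]mulr1; apply: QM. Qed.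

Let least f : (exists d, (f d)`_0 != 0) ->
  exists2 d, (f d)`_0 != 0 & forall e, (e < d)%N -> (f e)`_0 = 0.
Proof.
move=> ex; case: (ex_minnP ex) => d fd dmin; exists d => // e.
by apply: contraTeq => /dmin; rewrite leqNgt.
Qed.

Let Q_px : Q px -> forall f, Q f -> exists h, f = px * h.
Proof.
move=> Qx f Qf; apply: px_div; apply: contrapT => /existsNP[d0 /eqP fd0].
have [d fd f0] := least (ex_intro _ d0 fd0).
have [w [h [fE wE]]] := plane_split f0.
have [|v wv] := @plane_inv _ w; first by rewrite wE addn0.
have Qy : Q (py d).
  rewrite -[py d]mulr1 -wv mulrA mulrC; apply: QM.
  by rewrite -(addrK (px * h) (py d * w)) -fE; apply: QB => //; rewrite mulrC; apply: QM.
have {}Qy : Q (py 1).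
  case: d Qy {fd f0 fE wE} => [Qy|d].
    suff E : 1 = py 0 by case: Q1; rewrite E.
    by apply: planeP => -[|e]; rewrite pyE.
  rewrite py_expr; elim: d => // d IH; rewrite exprS => /Qprime[//|]; exact: IH.
have [t t0 Qt] := Qmax; apply: Qt.
have [|w' [h' [-> _]]] := @plane_split t 1; first by case.
by apply: QD; rewrite mulrC; apply: QM.
Qed.

(** The ring of power series in two variables modulo [x] is the discrete
    valuation ring of power series in [y].  A nonmaximal prime containing [x]
    is generated by [x]; any other prime is generated, first modulo [x] and
    hence exactly, by an element whose [y]-order modulo [x] is minimal. *)
Lemma plane_prime_principal : exists2 g, Q g & forall f, Q f -> exists a, f = a * g.
Proof.
have [Qx|Qx] := pselect (Q px).
  by exists px => // f /(Q_px Qx)[h ->]; exists h; rewrite mulrC.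
suff [g Qg gE] : exists2 g, Q g & forall f, Q f -> exists c h, f = c * g + px * h.
  exists g => // f Qf.
  have : f \in ispan [set` [:: g]].
    apply: (complete_lift_span (Q := Q) (@px_complete k) (@px_separated k)) Qf => {}f Qf.
    have [c [h fE]] := gE f Qf; exists (c * g), h; split=> //.
      by apply: (@idealM _ (Defs.span _)); apply: mem_span; rewrite /= mem_head.
    have : Q (px * h) by rewrite -(addKr (c * g) (px * h)) -fE addrC; apply/QB/QM.
    by case/Qprime.
  rewrite -range_tnth => /span_rangeP[a ->]; exists (a ord0).
  by rewrite big_ord1.
have [ex|nex] := pselect (exists d f, Q f /\ (f d)`_0 != 0); last first.
  exists 0 => // f Qf; exists 0; rewrite mul0r.
  have [|h fE] := @px_div f; last by exists h; rewrite add0r.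
  move=> d; apply: contrapT => /eqP fd; apply: nex; by exists d, f.
have exb : exists d, `[< exists f, Q f /\ (f d)`_0 != 0 >].
  by have [d H] := ex; exists d; apply/asboolP.
case: (ex_minnP exb) => d /asboolP[g [Qg gd]] dmin; exists g => //.
have low f e : Q f -> (e < d)%N -> (f e)`_0 = 0.
  move=> Qf ed; apply: contrapT => /eqP fe.
  have /dmin : `[< exists f, Q f /\ (f e)`_0 != 0 >] by apply/asboolP; exists f.
  by rewrite leqNgt ed.
have [w [h [gE wE]]] := plane_split (fun e => low g e Qg).
have [|v wv] := @plane_inv _ w; first by rewrite wE addn0.
move=> f Qf; have [w' [h' [-> _]]] := plane_split (fun e => low f e Qf).
exists (w' * v), (h' - w' * v * h); rewrite gE.
transitivity (w' * (w * v) * py d + px * h'); first by rewrite wv; ring.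
by ring.
Qed.

End PrimePrincipal.
End Domain.

(** * Primes and dimension of the pinched plane *)

Section Pinch.
Variable k : fieldType.
Notation R := (pinch k).
Implicit Types (f g : plane k) (r s : R).
Notation rx := (rx k).
Notation px := (px k).

Definition rmax : {pred R} := fun r => r 0 == 0.

Lemma rmax_idealr : idealr_closed rmax.
Proof.
split=> [||a u v /eqP u0 /eqP v0]; first exact/eqP.
  by apply/eqP => /eqP; rewrite oner_eq0.
apply/eqP; rewrite pinchD planeD pinchM planeM scoefM0.
by rewrite u0 v0 mulr0 addr0.
Qed.
HB.instance Definition _ := isIdealr.Build R rmax rmax_idealr.

Lemma rmaxP r : reflect (r 0 = 0) (r \in rmax).
Proof. exact: eqP. Qed.

Lemma rmax_coef r : (r \in rmax) = ((r 0)`_0 == 0).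
Proof.
apply/rmaxP/eqP => [->|r0]; first by rewrite coef0.
by rewrite [r 0]size1_polyC ?r0 //; exact: (plane_size r 0).
Qed.

Lemma notin_rmax_unit r : r \notin rmax -> exists s, s * r = 1.
Proof.
rewrite rmax_coef => /pinch_inv[s rs].
by exists s; rewrite mulrC.
Qed.

Lemma proper_sub_rmax (I : idealr R) : {subset I <= rmax}.
Proof.
move=> r rI; apply: contraT => /notin_rmax_unit[s sr].
by have := idealMr s rI; rewrite sr idealr1.
Qed.

Lemma pinch_local : local_ring (rmax : idealr R).
Proof.
have M : maximal_ideal rmax.
  split; first by exists (rmax : idealr R).
  by move=> I mI r; apply/idP/idP => [/mI//|/proper_sub_rmax].
split=> // m' [[m0 m0E] m'max].
apply: m'max => r; rewrite m0E; exact: proper_sub_rmax.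
Qed.

Lemma nonmaximal_prime (p : prime_idealr R) : ~ maximal_ideal p ->
  exists2 u, u \in rmax & u \notin p.
Proof.
move=> np; apply: contrapT => H; apply: np.
have pm : p =i rmax.
  move=> r; apply/idP/idP => [/proper_sub_rmax//|rm].
  by apply: contrapT => /negP rp; apply: H; exists r.
split; first by exists (p : idealr R).
move=> I pI r; apply/idP/idP => [/pI//|/proper_sub_rmax].
by rewrite pm.
Qed.

(** The maximal ideal of the pinched plane is an ideal of the plane. *)
Lemma rmax_absorb r f : r \in rmax ->
  exists2 s, pinch_val s = pinch_val r * f & s \in rmax.
Proof.
move=> /rmaxP r0; have [|s sE] := @pinch_of _ (pinch_val r * f).
  by rewrite planeM scoefM1 r0 pinch_coef1 !mul0r addr0.
by exists s => //; apply/rmaxP; rewrite sE planeM scoefM0 r0 mul0r.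
Qed.

(** The plane prime above a nonmaximal prime [p]: the conductor of the pinch in
    the plane is the maximal ideal, so localizing at [p] sees no difference
    between the two rings. *)
Definition above (p : {pred R}) f : Prop :=
  forall u s, u \in rmax -> pinch_val s = pinch_val u * f -> s \in p.

Section Above.
Variables (p : prime_idealr R) (u : R).
Hypotheses (um : u \in rmax) (up : u \notin p).

Lemma above_val r : above p r <-> r \in p.
Proof.
split=> [/(_ u (u * r) um (pinchM _ _))|rp v s vm].
  by rewrite prime_idealrM (negPf up).
by rewrite -pinchM => /pinch_inj ->; apply: idealMr.
Qed.

Lemma aboveP f s : pinch_val s = pinch_val u * f -> s \in p -> above p f.
Proof.
move=> sE sp v t vm tE; have : u * t \in p.
  rewrite (_ : u * t = v * s); first exact: idealMr.
  by apply: pinch_inj; rewrite !pinchM sE tE mulrCA.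
by rewrite prime_idealrM (negPf up).
Qed.

Lemma above_principal : exists2 g, above p g &
  forall f, above p f -> exists a, f = a * g.
Proof.
apply: plane_prime_principal => [v s vm|f g Hf Hg|f g Hg v s vm sE|f g H|].
- by rewrite mulr0 => /(@pinch_inj _ _ 0) ->; rewrite rpred0.
- have [a aE _] := rmax_absorb f um; have [b bE _] := rmax_absorb g um.
  apply: (aboveP (s := a - b)); first by rewrite pinchB aE bE mulrBr.
  by rewrite rpredB ?(Hf _ _ um aE) ?(Hg _ _ um bE).
- have [t tE tm] := rmax_absorb f vm.
  by apply: (Hg t) => //; rewrite sE tE mulrA.
- have [a aE am] := rmax_absorb f um; have [b bE _] := rmax_absorb g um.
  have : a * b \in p.
    have [c cE cm] := rmax_absorb (pinch_val u) um.
    by apply: (H c) => //; rewrite pinchM aE bE cE; ring.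
  by rewrite prime_idealrM => /orP[/(aboveP aE)|/(aboveP bE)]; [left|right].
- exists (pinch_val u); first by move/rmaxP: um => ->; rewrite coef0.
  by move=> /above_val; rewrite (negPf up).
Qed.

(** If [g] generates the plane prime above [p], then [t = u g] generates [p]
    locally: for [r = a g] in [p], [u^2 r = (u a) (u g)]. *)
Lemma local_principal : exists2 t, t \in p &
  forall r, r \in p -> exists2 s, s \notin p & exists a, s * r = t * a.
Proof.
have [g gp gE] := above_principal.
have [t tE _] := rmax_absorb g um; exists t; first exact: gp tE.
move=> r /above_val /gE[f rE]; have [a aE _] := rmax_absorb f um.
exists (u * u); first by rewrite prime_idealrM (negPf up).
by exists a; apply: pinch_inj; rewrite !pinchM rE tE aE; ring.
Qed.

End Above.

(** Let [(g1)] and [(g2)] be the plane primes above [p1] and [p2]. Then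
    [g1 = f g2]; as [g2] is not in [(g1)], primality gives [f = h g1], so that
    [g1 (1 - h g2) = 0] while [g2] is not a unit. *)
Lemma no_intermediate_prime (p1 p2 : prime_idealr R) u :
  psubset p1 p2 -> u \in rmax -> u \notin p2 -> forall r, r \in p1 -> r = 0.
Proof.
move=> [p12 p21] um up2; have up1 : u \notin p1 by apply: contra up2 => /p12.
have [g1 g1p g1E] := above_principal um up1.
have [g2 g2p g2E] := above_principal um up2.
have p1prime f g : above p1 (f * g) -> above p1 f \/ above p1 g.
  move=> H; have [a aE am] := rmax_absorb f um; have [b bE _] := rmax_absorb g um.
  have : a * b \in p1.
    have [c cE cm] := rmax_absorb (pinch_val u) um.
    by apply: (H c) => //; rewrite pinchM aE bE cE; ring.
  rewrite prime_idealrM => /orP[] H'; [left|right].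
    exact: (aboveP up1 aE H').
  exact: (aboveP up1 bE H').
have [f g12] : exists f, g1 = f * g2.
  by apply: g2E => v s vm /(g1p _ _ vm) /p12.
have : above p1 (f * g2) by rewrite -g12.
case/p1prime => [/g1E[h fE]|Hg2]; last first.
  case: p21 => r /(above_val um up2) /g2E[a rE].
  apply/(above_val um up1) => v s vm; rewrite rE => sE.
  have [c cE cm] := rmax_absorb a vm; apply: (Hg2 c) => //.
  by rewrite sE cE mulrA.
have : g1 * (1 - h * g2) = 0 by rewrite mulrBr mulr1 {1}g12 fE; ring.
case/plane_mulf_eq0 => [g10 r /(above_val um up1) /g1E[a]|/subr0_eq hg].
  by rewrite g10 mulr0 => /(@pinch_inj _ _ 0).
case/negP: up2; have [c cE cm] := rmax_absorb h um.
by apply: (g2p c) => //; rewrite cE -mulrA -hg mulr1.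
Qed.

(** The prime cut out by [x = 0], whose quotient is [k[[y^2,y^3]]]. *)
Definition modx : {pred R} := fun r => `[< forall d, (r d)`_0 = 0 >].

Lemma modxM r s : Powser (fun d => ((r * s : R) d)`_0) =
  Powser (fun d => (r d)`_0) * Powser (fun d => (s d)`_0).
Proof.
apply/powserP => d; transitivity ((plane_val r * plane_val s) d)`_0 => //.
rewrite !scoefM coef_sum.
by apply: eq_bigr => i _; rewrite coef0M.
Qed.

Lemma modx_idealr : idealr_closed modx.
Proof.
split=> [||a u v /asboolP uP /asboolP vP].
- by apply/asboolP => d; rewrite coef0.
- by apply/asboolP => /(_ 0)/eqP; rewrite coef1 oner_eq0.
apply/asboolP => d; rewrite pinchD planeD coefD vP addr0.
suff /powserP/(_ d) : Powser (fun d => ((a * u : R) d)`_0) = 0 by [].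
by rewrite modxM (_ : Powser (fun d => (u d)`_0) = 0) ?mulr0 //; exact/powserP.
Qed.

Lemma modx_prime : prime_idealr_closed modx.
Proof.
move=> u v /asboolP uvP; have := modxM u v.
rewrite (_ : Powser _ = 0); last exact/powserP.
by move=> /esym/powser_mulf_eq0[] /powserP H; apply/orP; [left|right]; apply/asboolP.
Qed.

Lemma rmax_prime : prime_idealr_closed rmax.
Proof.
by move=> u v /rmaxP; rewrite pinchM planeM scoefM0 => /eqP; rewrite mulf_eq0.
Qed.

(** The chain is [0], the prime cut out by [x = 0], [rmax]. *)
Lemma pinch_dim : krull_dim R 2.
Proof.
have dom (u v : R) : u * v = 0 -> u = 0 \/ v = 0.
  by move=> /eqP; rewrite mulf_eq0 => /orP[]/eqP->; [left|right].
split=> [|n [p pE]].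
  exists (fun n => if n is n'.+1 then
    if n' is 0 then prime_of modx_idealr modx_prime
    else prime_of rmax_idealr rmax_prime
    else prime_of (zero_idealr R) (zero_prime dom)).
  case=> [|[|//]] _; split.
  - by move=> r /eqP ->; apply/asboolP => d; rewrite coef0.
  - move=> /(_ rx) H; have /eqP/(congr1 (fun r : R => r 2)) : rx \in zero_ideal (R := R).
      apply: H; apply/asboolP => d; rewrite rxE pxE /=.
      by case: eqP => _; rewrite ?coefX ?coef0.
    by rewrite rxE pxE /= => /eqP; rewrite polyX_eq0.
  - by move=> r /asboolP r0; rewrite [_ \in _]rmax_coef r0.
  - move=> /(_ (pinch_mono 2 1)) H.
    have /asboolP/(_ 2) : pinch_mono 2 1 \in modx.
      by apply: H; rewrite [_ \in _]rmax_coef pinch_monoE ?size_poly1 //= coef0.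
    by rewrite pinch_monoE ?size_poly1 //= coef1 => /eqP; rewrite oner_eq0.
rewrite leqNgt; apply/negP => n2.
have [_ p01] := pE 0 (ltn_trans (ltn0Sn 1) n2).
have p12 := pE 1 (ltn_trans (ltnSn 1) n2).
have [_ /existsNP[u /not_implyP[u3 /negP u2]]] := pE 2 n2.
apply: p01 => r r1.
by rewrite (no_intermediate_prime p12 (proper_sub_rmax u3) u2 r1) rpred0.
Qed.
End Pinch.

(** * The pinched plane is Noetherian *)

Section PinchNoetherian.
Variable k : fieldType.
Notation R := (pinch k).
Implicit Types r s : R.
Notation rx := (rx k).
Notation px := (px k).

Definition rconst (c : k) : R := pinch_mono 0 c%:P.

Lemma rconst_coef c r d : (rconst c * r : R) d = c%:P * r d.
Proof.
rewrite pinchM planeM pinch_monoE ?size_polyC_leq1 //.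
by rewrite smonoM subn0.
Qed.

(** A linear form on an ideal has a kernel of codimension at most one, so
    each coefficient can be cleared with a single element. *)
Lemma clear_coef (P : R -> Prop) d i : P 0 ->
  exists2 g : R, P g & forall r, P r -> exists c, ((r - rconst c * g : R) d)`_i = 0.
Proof.
move=> P0; have [[g [Pg gd]]|H] := pselect (exists g : R, P g /\ (g d)`_i != 0).
  exists g => // r Pr; exists ((r d)`_i / (g d)`_i).
  by rewrite pinchB planeB rconst_coef coefB coefCM divfK // subrr.
exists 0 => // r Pr; exists 0; rewrite mulr0 subr0; apply: contrapT => /eqP rd.
by apply: H; exists r.
Qed.

(** Modulo [x] in the plane an ideal of the pinched plane becomes an ideal of
    [k[[y^2,y^3]]]. If [d] is the least order in [y] occurring in it and [a] has
    order [d], all series of order at least [d+2] are multiples of [a], so one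
    more element [b] clearing the coefficient of [y^(d+1)] suffices. *)
Lemma mod_plane_x (I : submodClosed R^o) : exists a b : R,
  [/\ a \in I, b \in I & forall r, r \in I -> exists c1 c2 h,
    pinch_val r = pinch_val (c1 * a + c2 * b) + px * h].
Proof.
have [ex|nex] := pselect (exists d r, r \in I /\ (r d)`_0 != 0); last first.
  exists 0, 0; split; [exact: (@rpred0 _ I)|exact: (@rpred0 _ I)|move=> r rI].
  exists 0, 0; have [|h rE] := @px_div _ (pinch_val r); last first.
    by exists h; rewrite !mulr0 addr0 rE -[LHS]add0r.
  move=> d; apply: contrapT => /eqP rd; apply: nex; by exists d, r.
have exb : exists d, `[< exists r, r \in I /\ (r d)`_0 != 0 >].
  by have [d H] := ex; exists d; apply/asboolP.
have I0 : (0 : R) \in I by exact: (@rpred0 _ I).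
case: (ex_minnP exb) => d /asboolP[a [aI ad]] dmin.
have low r e : r \in I -> (e < d)%N -> (r e)`_0 = 0.
  move=> rI ed; apply: contrapT => /eqP re.
  have /dmin : `[< exists r, r \in I /\ (r e)`_0 != 0 >] by apply/asboolP; exists r.
  by rewrite leqNgt ed.
have pinch0 : ((0 : R) d)`_0 = 0 by rewrite plane0 coef0.
have [b [bI bd] bE] := @clear_coef (fun r => r \in I /\ (r d)`_0 = 0) d.+1 0
  (conj I0 pinch0).
exists a, b; split=> // r rI.
have [w [h [aE wE]]] := plane_split (fun e => low a e aI).
have [|v wv] := @plane_inv _ w; first by rewrite wE addn0.
pose c1 := rconst ((r d)`_0 / (a d)`_0).
have r1I : r - c1 * a \in I by apply: idealB => //; apply: idealM.
have r1d : ((r - c1 * a : R) d)`_0 = 0.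
  by rewrite pinchB planeB rconst_coef coefB coefCM divfK // subrr.
have [c2 r2d] := bE _ (conj r1I r1d).
have r2I : r - c1 * a - rconst c2 * b \in I by apply: idealB => //; apply: idealM.
have [|w2 [h2 [r2E _]]] := @plane_split _ (pinch_val (r - c1 * a - rconst c2 * b)) d.+2.
  move=> e; rewrite !ltnS leq_eqVlt => /orP[/eqP->//|].
  rewrite ltnS leq_eqVlt => /orP[/eqP->|]; last exact: low.
  by rewrite pinchB planeB coefB r1d rconst_coef coefCM bd mulr0 subr0.
have [c3 c3E] : exists c : R, pinch_val c = py k 2 * (w2 * v).
  by apply: pinch_of; rewrite py_coef.
exists (c1 + c3), (rconst c2), (h2 - py k 2 * w2 * v * h).
have -> : pinch_val r = pinch_val (r - c1 * a - rconst c2 * b) + pinch_val (c1 * a + rconst c2 * b).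
  by rewrite -pinchD; congr pinch_val; ring.
have py2 : py k d.+2 = py k 2 * py k d.
  by apply: planeP => -[|[|e]]; rewrite py_coef !pyE /= ?subn2.
rewrite r2E py2 !pinchD !pinchM pinchD c3E aE.
transitivity (py k 2 * py k d * w2 * (w * v) + px * h2 +
  (pinch_val c1 * (py k d * w + px * h) + pinch_val (rconst c2) * pinch_val b)).
  by rewrite wv; ring.
by ring.
Qed.

(** The plane modulo the pinched plane is spanned by [y], so a third generator,
    among the elements divisible by [x] in the plane, turns generation modulo
    [x] in the plane into generation modulo [x] in the pinched plane. *)
Lemma pinch_noetherian : noetherian R.
Proof.
apply: (complete_noetherian (@rx_complete k) (@rx_separated k)) => I.
have [a [b [aI bI abE]]] := mod_plane_x I.
have I0 : (0 : R) \in I by exact: (@rpred0 _ I).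
(* For [r = x h], the coefficient of [u s^3] in [r] is that of [y] in [h]. *)
have [e [eI [e' eE]] ePr] := @clear_coef
  (fun r => r \in I /\ exists h, pinch_val r = px * h) 3 1
  (conj I0 (ex_intro _ 0 (esym (mulr0 px)))).
exists [:: a; b; e]; split=> [r|r rI].
  by rewrite !inE => /or3P[]/eqP->.
have [c1 [c2 [h rE]]] := abE r rI.
have r1I : r - (c1 * a + c2 * b) \in I.
  by apply: idealB => //; apply: idealD; apply: idealM.
have r1E : pinch_val (r - (c1 * a + c2 * b)) = px * h.
  by rewrite pinchB rE addrC addKr.
have [c cE] := ePr _ (conj r1I (ex_intro _ h r1E)).
have cEx : pinch_val (r - (c1 * a + c2 * b) - rconst c * e) =
    px * (h - pinch_val (rconst c) * e').
  by rewrite pinchB r1E pinchM eE; ring.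
have [|s sE] := @pinch_of _ (h - pinch_val (rconst c) * e').
  rewrite [LHS]size1_polyC; last exact: plane_size _ 1.
  by move: cE; rewrite cEx px_coef coefXM /= => ->.
exists (c1 * a + c2 * b + rconst c * e), s; split.
  apply: (@idealD _ (Defs.span _)); last first.
    by apply: (@idealM _ (Defs.span _)); apply: mem_span; rewrite /= !inE eqxx !orbT.
  by apply: (@idealD _ (Defs.span _)); apply: (@idealM _ (Defs.span _));
    apply: mem_span; rewrite /= !inE eqxx ?orbT.
apply: pinch_inj; rewrite pinchD pinchM sE rxE -cEx -pinchD.
by congr pinch_val; ring.
Qed.
End PinchNoetherian.

(** * Localization of a domain at a prime *)

Section Localization.
Variables (R : idomainType) (p : prime_idealr R).
Local Notation F := {fraction R}.
Local Notation tofrac := (@tofrac R).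

(** The localization is the ring of fractions with denominator outside [p],
    inside the field of fractions. *)
Definition fracs : {pred F} := fun z =>
  `[< exists a s, s \notin p /\ z = tofrac a / tofrac s >].

Let notin0 s : s \notin p -> tofrac s != 0.
Proof. by rewrite tofrac_eq0; apply: contra => /eqP ->; rewrite rpred0. Qed.

Let notin1 : 1 \notin p. Proof. by rewrite idealr1. Qed.

Let notinM s t : s \notin p -> t \notin p -> s * t \notin p.
Proof. by move=> sp tp; rewrite prime_idealrM negb_or sp. Qed.

Lemma fracs_subring : subring_closed fracs.
Proof.
split=> [|_ _ /asboolP[a [s [sp ->]]] /asboolP[b [t [tp ->]]]
         |_ _ /asboolP[a [s [sp ->]]] /asboolP[b [t [tp ->]]]]; apply/asboolP.
- by exists 1, 1; split=> //; rewrite tofrac1 divr1.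
- exists (a * t - b * s), (s * t); split; first exact: notinM.
  by rewrite tofracB !tofracM -mulNr addf_div ?notin0 // mulNr.
- exists (a * b), (s * t); split; first exact: notinM.
  by rewrite !tofracM invfM mulrACA.
Qed.
HB.instance Definition _ := GRing.isSubringClosed.Build F fracs fracs_subring.

Record loc := Loc { loc_val :> F; _ : loc_val \in fracs }.
HB.instance Definition _ := [isSub of loc for loc_val].
HB.instance Definition _ := [Choice of loc by <:].
HB.instance Definition _ := [SubChoice_isSubComNzRing of loc by <:].

Lemma loc_inj : injective loc_val. Proof. exact: val_inj. Qed.
Lemma locM (z w : loc) : loc_val (z * w) = loc_val z * loc_val w. Proof. by []. Qed.

Lemma fracs_tofrac a : tofrac a \in fracs.
Proof. by apply/asboolP; exists a, 1; split=> //; rewrite tofrac1 divr1. Qed.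

Definition to_loc (a : R) : loc := Loc (fracs_tofrac a).

Fact to_loc_zmod : zmod_morphism to_loc.
Proof. by move=> a b; apply: loc_inj; exact: tofracB. Qed.
Fact to_loc_monoid : monoid_morphism to_loc.
Proof.
by split=> [|a b]; apply: loc_inj; [exact: tofrac1|exact: tofracM].
Qed.
HB.instance Definition _ := GRing.isZmodMorphism.Build R loc to_loc to_loc_zmod.
HB.instance Definition _ := GRing.isMonoidMorphism.Build R loc to_loc to_loc_monoid.

Lemma to_locM a b : to_loc (a * b) = to_loc a * to_loc b. Proof. exact: rmorphM. Qed.
Lemma to_locD a b : to_loc (a + b) = to_loc a + to_loc b. Proof. exact: rmorphD. Qed.
Lemma to_loc0 : to_loc 0 = 0. Proof. exact: rmorph0. Qed.
Lemma to_loc1 : to_loc 1 = 1. Proof. exact: rmorph1. Qed.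

Lemma to_loc_inj : injective to_loc.
Proof. by move=> a b /(congr1 loc_val)/eqP; rewrite tofrac_eq => /eqP. Qed.

Lemma to_loc_unit s : s \notin p -> exists t, to_loc s * t = 1.
Proof.
move=> sp; have fs : (tofrac s)^-1 \in fracs.
  by apply/asboolP; exists 1, s; split=> //; rewrite tofrac1 mul1r.
by exists (Loc fs); apply: loc_inj; rewrite locM mulfV ?notin0.
Qed.

Lemma locP (z : loc) : exists a s, s \notin p /\ z * to_loc s = to_loc a.
Proof.
have /asboolP[a [s [sp zE]]] := valP z.
by exists a, s; split=> //; apply: loc_inj; rewrite locM zE divfK ?notin0.
Qed.

Lemma loc_dom (z w : loc) : z * w = 0 -> z = 0 \/ w = 0.
Proof.
move=> /(congr1 loc_val)/eqP; rewrite locM mulf_eq0.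
by case/orP => /eqP H; [left|right]; apply: loc_inj.
Qed.

Lemma to_loc_is_localization : is_localization p to_loc.
Proof.
split; [exact: to_loc_unit|exact: locP|move=> a a0; exists 1 => //].
by rewrite mul1r; apply: to_loc_inj; rewrite a0 to_loc0.
Qed.

Definition loc_max : {pred loc} := fun z =>
  `[< exists a s, [/\ a \in p, s \notin p & z * to_loc s = to_loc a] >].

Lemma to_loc_max a : (to_loc a \in loc_max) = (a \in p).
Proof.
apply/asboolP/idP => [[b [s [bp sp]]]|ap]; last first.
  by exists a, 1; split=> //; rewrite to_loc1 mulr1.
rewrite -to_locM => /to_loc_inj ab; move: bp.
by rewrite -ab prime_idealrM (negPf sp) orbF.
Qed.

Lemma loc_max_idealr : idealr_closed loc_max.
Proof.
split=> [||z u v /asboolP[a [s [ap sp uE]]] /asboolP[b [t [bp tp vE]]]].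
- by rewrite -to_loc0 to_loc_max rpred0.
- by rewrite -to_loc1 to_loc_max.
have [c [w [wp zE]]] := locP z; apply/asboolP.
exists (t * c * a + w * s * b), (w * s * t); split.
- by rewrite rpredD // idealMr.
- by rewrite !notinM.
by rewrite to_locD !to_locM -zE -uE -vE; ring.
Qed.
HB.instance Definition _ := isIdealr.Build loc loc_max loc_max_idealr.

Lemma loc_max_prime : prime_idealr_closed loc_max.
Proof.
move=> u v; have [a [s [sp uE]]] := locP u; have [b [t [tp vE]]] := locP v.
move=> uv; have : to_loc (a * b) \in loc_max.
  rewrite to_locM -uE -vE mulrACA mulrC.
  exact: (@idealMr _ (loc_max : idealr loc)).
by rewrite to_loc_max prime_idealrM => /orP[] H; apply/orP; [left|right];
  apply/asboolP; [exists a, s|exists b, t].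
Qed.

Lemma loc_unit (z : loc) : z \notin loc_max -> exists w, w * z = 1.
Proof.
have [a [s [sp zE]]] := locP z => zn.
have /to_loc_unit[t tE] : a \notin p.
  by apply: contra zn => ap; apply/asboolP; exists a, s.
by exists (to_loc s * t); rewrite -tE -zE; ring.
Qed.

Lemma proper_sub_loc_max (I : idealr loc) : {subset I <= loc_max}.
Proof.
move=> r rI; apply: contraT => /loc_unit[s sr].
by have := idealMr s rI; rewrite sr idealr1.
Qed.

Lemma loc_local : local_ring (loc_max : idealr loc).
Proof.
split=> [|m' [[m0 m0E] m'max]].
  split; first by exists (loc_max : idealr loc).
  by move=> I mI r; apply/idP/idP => [/mI//|/proper_sub_loc_max].
apply: m'max => r; rewrite m0E; exact: proper_sub_loc_max.
Qed.

Lemma loc_noetherian : noetherian R -> noetherian loc.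
Proof.
move=> nR I; pose C : {pred R^o} := fun a => to_loc a \in I.
have CE a : (a \in C) = (to_loc a \in I) by [].
have C_closed : submod_closed C.
  split=> [|a u v]; rewrite !CE; first by rewrite to_loc0 (@rpred0 _ I).
  move=> uI vI; rewrite to_locD to_locM; apply: idealD => //.
  exact: idealM.
have [s [sC Cs]] := (fin_genP (submod_of C_closed)).1 (nR _).
apply/fin_genP; exists [seq to_loc a | a <- s]; split=> [z /mapP[a /sC aC ->//]|z zI].
have [a [t [tp zE]]] := locP z; have [w tw] := to_loc_unit tp.
have -> : z = w * to_loc a by rewrite -zE mulrCA (mulrC w) tw mulr1.
apply: (@idealM _ (Defs.span _)).
have /Cs : a \in submod_of C_closed.
  by rewrite -[_ \in _]/(to_loc a \in I) -zE mulrC; apply: idealM.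
move=> /asboolP[r [rs ->]]; rewrite (rmorph_sum to_loc) big_seq.
apply: (@rpred_sum _ (Defs.span _)) => y yr; rewrite -[X in X \in _]/(to_loc (y.1 * y.2)) to_locM.
by apply: (@idealM _ (Defs.span _)); apply: mem_span; apply/map_f/rs.
Qed.

Definition contract (P : prime_idealr loc) : {pred R} := fun a => to_loc a \in P.

Lemma contract_idealr P : idealr_closed (contract P).
Proof.
have CE a : (a \in contract P) = (to_loc a \in P) by [].
split=> [||a u v]; rewrite !CE ?to_loc0 ?rpred0 ?to_loc1 ?idealr1 //.
by move=> uP vP; rewrite to_locD to_locM rpredD // idealMr.
Qed.

Lemma contract_prime P : prime_idealr_closed (contract P).
Proof.
by move=> u v; rewrite -[_ \in _]/(to_loc (u * v) \in P) to_locM prime_idealrM.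
Qed.

Definition contracted P := prime_of (@contract_idealr P) (@contract_prime P).

Lemma contract_psubset (P Q : prime_idealr loc) :
  psubset P Q -> psubset (contracted P) (contracted Q).
Proof.
move=> [PQ nPQ]; split=> [a /PQ //|H]; apply: nPQ => z zQ.
have [a [s [sp zE]]] := locP z; have [w sw] := to_loc_unit sp.
have -> : z = w * to_loc a by rewrite -zE mulrCA (mulrC w) sw mulr1.
by apply: idealMr; apply: H; rewrite -[_ \in _]/(to_loc a \in Q) -zE mulrC idealMr.
Qed.

Lemma contracted_sub P : {subset contracted P <= p}.
Proof. by move=> a aP; rewrite -to_loc_max; exact: proper_sub_loc_max aP. Qed.

(** If [t = 0] the localization is a field. Otherwise its maximal ideal is
    generated by the nonzero element [t], and its primes, which contract to
    primes contained in [p], are this ideal and [0]. *)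
Lemma loc_regular (t : R) :
    noetherian R -> t \in p ->
    (forall r, r \in p -> exists2 s, s \notin p & exists a, s * r = t * a) ->
    (forall q : prime_idealr R, psubset q p -> forall r, r \in q -> r = 0) ->
  regular_local (loc_max : idealr loc).
Proof.
move=> nR tp tE ht; split; [exact: loc_noetherian|exact: loc_local|].
have maxE z : z \in loc_max -> exists w, z = w * to_loc t.
  move=> /asboolP[a [s [ap sp zE]]]; have [s' s'p [b bE]] := tE a ap.
  have [w sw] := to_loc_unit sp; have [w' sw'] := to_loc_unit s'p.
  exists (w * w' * to_loc b).
  transitivity (z * (to_loc s * w) * (to_loc s' * w')); first by rewrite sw sw' !mulr1.
  transitivity (w * w' * to_loc (t * b)); last by rewrite to_locM; ring.
  by rewrite -bE to_locM -zE; ring.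
have [t0|/eqP t0] := eqVneq t 0.
  have max0 z : z \in loc_max -> z = 0.
    by move=> /maxE[w ->]; rewrite t0 to_loc0 mulr0.
  exists 0; split=> //.
  - by exists (fun=> prime_of (zero_idealr loc) (zero_prime loc_dom)).
  - case=> // n [P PE]; have [_ []] := PE 0 (ltn0Sn n).
    by move=> z /proper_sub_loc_max/max0 ->; rewrite rpred0.
  - exists (fun=> 0) => z; apply/idP/idP => [/max0->|]; first exact: (@rpred0 _ (Defs.span _)).
    move=> /span_rangeP[a ->]; rewrite big_ord0; exact: (@rpred0 _ (loc_max : idealr loc)).
exists 1; split.
- exists (fun n => if n is 0 then prime_of (zero_idealr loc) (zero_prime loc_dom)
                   else prime_of loc_max_idealr loc_max_prime).
  case=> // _; split=> [z /eqP->|H]; first exact: (@rpred0 _ (loc_max : idealr loc)).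
  have /eqP : to_loc t \in zero_ideal (R := loc) by apply: H; rewrite [_ \in _]to_loc_max.
  by rewrite -to_loc0 => /to_loc_inj.
- move=> n [P PE]; rewrite leqNgt; apply/negP => n1.
  have [_ []] := contract_psubset (PE 0 (ltnW n1)).
  have p12 := contract_psubset (PE 1 n1).
  move=> r r1; rewrite (ht (contracted (P 1)) _ r r1) ?rpred0 //.
  case: p12 => p12 p21; split=> [a /p12/contracted_sub //|H].
  by apply: p21 => a /contracted_sub/H.
- exists (fun=> to_loc t) => z; apply/idP/idP => [/maxE[w ->]|].
    by apply/span_rangeP; exists (fun=> w); rewrite big_ord1.
  move=> /span_rangeP[a ->]; rewrite big_ord1.
  by apply: (@idealMr _ (loc_max : idealr loc)); rewrite to_loc_max.
- case=> // g /(_ (to_loc t)); rewrite to_loc_max tp => /esym /span_rangeP[a].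
  by rewrite big_ord0 -to_loc0 => /to_loc_inj.
Qed.

End Localization.

Lemma pinch_isolated (k : fieldType) : isolated_singularity (pinch k).
Proof.
move=> p /nonmaximal_prime[u um up].
exists (loc p), (to_loc p), (loc_max (p := p) : idealr (loc p)).
split; first exact: to_loc_is_localization.
have [t tp tE] := local_principal um up.
apply: (loc_regular (@pinch_noetherian k) tp tE) => q qp.
exact: (no_intermediate_prime qp um up).
Qed.

(** * The Hilbert basis theorem *)

Lemma seq_lift (S T : eqType) (h : T -> S) (P : T -> Prop) (s : seq S) :
    (forall a, a \in s -> exists2 f, P f & h f = a) ->
  exists2 t, (forall f, f \in t -> P f) & s = map h t.
Proof.
elim: s => [|a s IH] H; first by exists [::].
have [t tP ->] := IH (fun b bs => H b (mem_behead (s := a :: s) bs)).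
have [f fP fa] := H a (mem_head a s).
exists (f :: t); last by rewrite /= fa.
by move=> g; rewrite inE => /orP[/eqP->|/tP].
Qed.

Lemma size_XnM (A : comNzRingType) (f : {poly A}) n m :
  (n <= m)%N -> (size f <= n.+1)%N -> (size ('X^(m - n) * f)%R <= m.+1)%N.
Proof.
move=> nm sf; rewrite (leq_trans (size_polyMleq _ _)) // size_polyXn /=.
by rewrite -[X in (_ <= X.+1)%N](subnK nm) -addnS leq_add2l.
Qed.

Section Hilbert.
Variable A : comNzRingType.
Hypothesis nA : noetherian A.
Variable I : submodClosed {poly A}^o.

Let J n : {pred A^o} := fun a =>
  `[< exists f : {poly A}, [/\ f \in I, (size f <= n.+1)%N & f`_n = a] >].

Let J_closed n : submod_closed (J n).
Proof.
split=> [|a u v /asboolP[f [fI sf fu]] /asboolP[g [gI sg gv]]]; apply/asboolP.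
  by exists 0; split; rewrite ?size_poly0 ?coef0 //; exact: ideal0.
exists (a%:P * f + g); split; first by apply: idealD => //; apply: idealM.
  rewrite (leq_trans (size_polyD _ _)) // geq_max sg andbT.
  by rewrite mul_polyC (leq_trans (size_scale_leq _ _)).
by rewrite coefD coefCM fu gv.
Qed.

Let Jsat : {pred A^o} := fun a => `[< exists n, a \in J n >].

Let J_mono n m a : (n <= m)%N -> a \in J n -> a \in J m.
Proof.
move=> nm /asboolP[f [fI sf <-]]; apply/asboolP.
exists ('X^(m - n) * f); split; first exact: idealM.
  exact: size_XnM.
by rewrite coefXnM ltnNge leq_subr /= subKn.
Qed.

Let Jsat_closed : submod_closed Jsat.
Proof.
split=> [|a u v /asboolP[n un] /asboolP[m vm]]; apply/asboolP.
  by exists 0%N; exact: (J_closed 0).1.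
by exists (n + m)%N; apply: (J_closed _).2; [apply: J_mono un|apply: J_mono vm]; lia.
Qed.

Let lift_span n (t : seq {poly A}) : (forall f, f \in t -> (size f <= n.+1)%N) ->
  forall a, a \in ispan [set` [seq (f : {poly A})`_n | f <- t]] ->
  exists g : {poly A}, [/\ g \in ispan [set` t], (size g <= n.+1)%N & g`_n = a].
Proof.
move=> tn.
pose K : {pred A^o} := fun a => `[< exists g : {poly A},
  [/\ g \in ispan [set` t], (size g <= n.+1)%N & g`_n = a] >].
have K_closed : submod_closed K.
  split=> [|a u v /asboolP[f [fI sf fu]] /asboolP[g [gI sg gv]]]; apply/asboolP.
    exists 0; split; rewrite ?size_poly0 ?coef0 //.
    exact: (ideal0 (Defs.span _)).
  exists (a%:P * f + g); split.
  - by apply: (idealD (I := Defs.span _)) => //; apply: (idealM (I := Defs.span _)).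
  - rewrite (leq_trans (size_polyD _ _)) // geq_max sg andbT.
    by rewrite mul_polyC (leq_trans (size_scale_leq _ _)).
  by rewrite coefD coefCM fu gv.
move=> a /(@span_sub _ _ (submod_of K_closed)) aK.
apply/asboolP; apply: aK => _ /= /mapP[f ft ->]; apply/asboolP.
by exists f; split=> //; [exact: mem_span|exact: tn].
Qed.

(** The leading coefficients of the elements of [I] of degree at most [n] form
    ideals [J n] that become constant at some [D]; lifts of generators of
    [J 0], ..., [J D] generate [I]. *)
Lemma hilbert_fin_gen : fin_gen I.
Proof.
have [s [sJ Js]] := (fin_genP (submod_of Jsat_closed)).1 (nA _).
have [D sD] : exists D, forall a, a \in s -> a \in J D.
  have : {subset s <= Jsat} by [].
  elim: s {sJ Js} => [|a s IH] sJ; first by exists 0%N.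
  have /asboolP[n an] := sJ _ (mem_head a s).
  have [m sm] := IH (fun b bs => sJ b (mem_behead (s := a :: s) bs)).
  exists (n + m)%N => b; rewrite inE => /orP[/eqP->|/sm].
    by apply: J_mono an; lia.
  by apply: J_mono; lia.
have H n : exists t : seq {poly A},
    (forall f, f \in t -> f \in I /\ (size f <= n.+1)%N) /\
    {subset J n <= ispan [set` [seq (f : {poly A})`_n | f <- t]]}.
  have [r [rJ Jr]] := (fin_genP (submod_of (J_closed n))).1 (nA _).
  have [|t tP rE] := @seq_lift _ _ (fun f : {poly A} => f`_n)
    (fun f => f \in I /\ (size f <= n.+1)%N) r.
    by move=> a /rJ/asboolP[f [fI sf fa]]; exists f.
  by exists t; split=> //; rewrite -rE.
have [t tP] := choice H.
apply/fin_genP; exists (flatten [seq t i | i <- iota 0 D.+1]); split.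
  by move=> f /flattenP[_ /mapP[i _ ->]] /(tP i).1[].
have sub i f : (i <= D)%N -> f \in ispan [set` t i] ->
    f \in ispan [set` flatten [seq t i | i <- iota 0 D.+1]].
  move=> iD; apply: span_mono => g gt; apply/flattenP; exists (t i) => //.
  by apply/map_f; rewrite mem_iota.
have tI i f : f \in ispan [set` t i] -> f \in I.
  by apply: span_sub => g /= /(tP i).1[].
move=> f; move: {2}(size f) (leqnn (size f)) => n.
elim: n f => [|n IH] f sf fI.
  move: sf; rewrite leqn0 size_poly_eq0 => /eqP->; exact: (@rpred0 _ (Defs.span _)).
suff [i [g [iD gt sg gf]]] : exists i g,
    [/\ (i <= D)%N, g \in ispan [set` t i], (size g <= n.+1)%N & g`_n = f`_n].
  rewrite -(subrK g f) addrC; apply: (idealD (I := Defs.span _)); first exact: sub gt.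
  apply: IH; last by apply: idealB => //; exact: tI gt.
  apply/leq_sizeP => j; rewrite leq_eqVlt => /orP[/eqP<-|nj].
    by rewrite coefB gf subrr.
  by rewrite coefB !nth_default ?subrr // (leq_trans _ nj).
have [nD|Dn] := leqP n D.
  have /(tP n).2 : f`_n \in J n by apply/asboolP; exists f.
  move=> /(lift_span (fun g gt => ((tP n).1 g gt).2))[g [gt sg gf]].
  by exists n, g.
have fJ : f`_n \in J D.
  have /Js : f`_n \in Jsat by apply/asboolP; exists n; apply/asboolP; exists f.
  by apply: (@span_sub _ _ (submod_of (J_closed D))) => a /sD.
have /(lift_span (fun g gt => ((tP D).1 g gt).2))[g [gt sg gf]] := (tP D).2 _ fJ.
exists D, ('X^(n - D) * g); split=> //; first exact: (idealM (I := Defs.span _)).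
  by apply: size_XnM => //; exact: ltnW.
by rewrite coefXnM ltnNge leq_subr /= subKn // ltnW.
Qed.

End Hilbert.

Lemma hilbert_basis (A : comNzRingType) : noetherian A -> noetherian {poly A}.
Proof. by move=> nA I; exact: hilbert_fin_gen. Qed.

Lemma noetherian_surj (A B : comNzRingType) (f : {rmorphism A -> B}) :
  (forall b, exists a, f a = b) -> noetherian A -> noetherian B.
Proof.
move=> fS nA I; pose C : {pred A^o} := fun a => f a \in I.
have CE a : (a \in C) = (f a \in I) by [].
have C_closed : submod_closed C.
  split=> [|a u v]; rewrite !CE; first by rewrite rmorph0 (@rpred0 _ I).
  by move=> uI vI; rewrite rmorphD rmorphM; apply: idealD => //; apply: idealM.
have [s [sC Cs]] := (fin_genP (submod_of C_closed)).1 (nA _).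
apply/fin_genP; exists [seq f a | a <- s]; split=> [z /mapP[a /sC aC ->//]|z zI].
have [a az] := fS z; have /Cs/asboolP[r [rs aE]] : a \in submod_of C_closed.
  by rewrite -[_ \in _]/(f a \in I) az.
rewrite -az aE (rmorph_sum f) big_seq.
apply: (@rpred_sum _ (Defs.span _)) => y yr.
rewrite -[X in X \in _]/(f (y.1 * y.2)) rmorphM.
by apply: (@idealM _ (Defs.span _)); apply: mem_span; apply/map_f/rs.
Qed.

(** A Noetherian ring mapping to [B] can be enlarged, by adjoining variables, to
    one whose image contains any finite set. *)
Lemma adjoin_noetherian (A B : comNzRingType) (f : {rmorphism A -> B}) (bs : seq B) :
    noetherian A -> exists (A' : comNzRingType) (f' : {rmorphism A' -> B}),
  [/\ noetherian A', forall a, exists a', f' a' = f a &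
      forall b, b \in bs -> exists a', f' a' = b].
Proof.
move=> nA; elim: bs => [|b bs [A' [f' [nA' f'A f'bs]]]].
  by exists A, f; split=> // a; exists a.
have cfb : commr_rmorph f' b by move=> a; exact: mulrC.
exists {poly A'}, (horner_morph cfb); split.
- exact: hilbert_basis.
- by move=> a; have [a' <-] := f'A a; exists a'%:P; exact: horner_morphC.
move=> c; rewrite inE => /orP[/eqP->|/f'bs[a' <-]].
  by exists 'X; exact: horner_morphX.
by exists a'%:P; exact: horner_morphC.
Qed.

(** * Rees algebras, associated graded rings and nilpotent quotients *)

Section ReesNoetherian.
Variables (R : comNzRingType) (m : idealr R).

Lemma rees_inj : injective (@rees_val R m). Proof. exact: val_inj. Qed.
Lemma reesM (p q : rees m) : rees_val (p * q) = rees_val p * rees_val q.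
Proof. by []. Qed.
Lemma reesD (p q : rees m) : rees_val (p + q) = rees_val p + rees_val q.
Proof. by []. Qed.

Lemma mem_ideal_pow1 a : a \in m -> a \in ideal_pow m 1.
Proof.
move=> am; have := @ideal_pow_prod _ m 1 (fun=> a) (fun=> am).
by rewrite big_ord1.
Qed.

Fact rees_const_subproof (a : R) : a%:P \in in_rees m.
Proof.
apply/asboolP => -[|i]; first exact: ideal_pow0.
by rewrite coefC; exact: (@ideal0 _ (ideal_pow m i.+1)).
Qed.
Definition rees_const a : rees m := Rees (rees_const_subproof a).

Fact rees_const_zmod : zmod_morphism rees_const.
Proof. by move=> a b; apply: rees_inj; exact: polyCB. Qed.
Fact rees_const_monoid : monoid_morphism rees_const.
Proof. by split=> [|a b]; apply: rees_inj; [exact: polyC1|exact: polyCM]. Qed.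
HB.instance Definition _ := GRing.isZmodMorphism.Build R (rees m) rees_const rees_const_zmod.
HB.instance Definition _ := GRing.isMonoidMorphism.Build R (rees m) rees_const rees_const_monoid.

Fact rees_gen_subproof a : a \in m -> a *: 'X \in in_rees m.
Proof.
move=> am; apply/asboolP => i; rewrite coefZ coefX.
have [->|_] := eqVneq; first by rewrite mulr1 mem_ideal_pow1.
by rewrite mulr0; exact: (@ideal0 _ (ideal_pow m i)).
Qed.

(** The Rees algebra is generated over [R] by the [a T] with [a] among finitely
    many generators of [m], so it is a quotient of a polynomial ring. *)
Lemma rees_noetherian : noetherian R -> noetherian (rees m).
Proof.
move=> nR.
have m_closed : submod_closed (m : {pred R^o}).
  by split=> [|a u v um vm]; rewrite ?rpred0 // rpredD // idealMr.
have [s [sm ms]] := (fin_genP (submod_of m_closed)).1 (nR _).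
have [|t _ tE] := @seq_lift _ _ (@rees_val R m) (fun=> True) [seq a *: 'X | a <- s].
  by move=> _ /mapP[a /sm am ->]; exists (Rees (rees_gen_subproof am)).
have [A [f [nA fR ft]]] := adjoin_noetherian rees_const t nR.
apply: (noetherian_surj (f := f)) nA => p.
pose im (q : {poly R}) := exists z, rees_val (f z) = q.
have imM p1 p2 : im p1 -> im p2 -> im (p1 * p2).
  by move=> [z1 <-] [z2 <-]; exists (z1 * z2); rewrite rmorphM reesM.
have imD p1 p2 : im p1 -> im p2 -> im (p1 + p2).
  by move=> [z1 <-] [z2 <-]; exists (z1 + z2); rewrite rmorphD reesD.
have im0 : im 0 by exists 0; rewrite rmorph0.
have imC a : im a%:P by have [z zE] := fR a; exists z; rewrite zE.
have ims a : a \in s -> im (a *: 'X).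
  move=> /(map_f (fun a => a *: 'X)); rewrite tE => /mapP[z zt ->].
  by have [y yE] := ft z zt; exists y; rewrite yE.
have im1 a : a \in m -> im (a *: 'X).
  move=> am; have /ms/asboolP[r [rs ->]] : a \in submod_of m_closed by [].
  rewrite scaler_suml big_seq; elim/big_ind: _ => // z zr.
  rewrite -[z.1 *: z.2]/(z.1 * z.2) -scalerA -mul_polyC.
  by apply: (imM) => //; apply: ims; exact: rs.
have imn i a : a \in ideal_pow m i -> im (a *: 'X^i).
  move=> /asboolP[r [rP ->]]; rewrite scaler_suml big_seq.
  elim/big_ind: _ => // z zr; rewrite -[z.1 *: z.2]/(z.1 * z.2) -scalerA -mul_polyC.
  apply: (imM) => //; have [u uP <-] := rP z zr.
  elim: i u uP {rP zr} => [|i IH] u uP.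
    by rewrite big_ord0 scale1r expr0; exact: (imC 1).
  rewrite big_ord_recl exprS -scalerA scalerAr scalerAl.
  by apply: (imM); [apply: im1|apply: IH => j; exact: uP].
have [z zE] : im (rees_val p).
  have /asboolP pP := valP p.
  rewrite -[rees_val p]coefK poly_def; elim/big_ind: _ => // i _.
  exact/imn/pP.
by exists z; exact: rees_inj.
Qed.

Lemma assoc_graded_noetherian : noetherian R -> noetherian (assoc_graded m).
Proof.
move=> nR; pose pi : {rmorphism rees m -> assoc_graded m} :=
  (\pi_(Quotient.quot (rees_shift (m := m))))%qT.
apply: (noetherian_surj (f := pi)); last exact: rees_noetherian.
by move=> x; exists (repr (x : Quotient.quot (rees_shift (m := m)))); exact: reprK.
Qed.
End ReesNoetherian.

Section NilQuotient.
Variables (G : comNzRingType) (I : idealr G).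
Hypothesis nilI : forall p : prime_idealr G, {subset I <= p}.
Notation Q := {ideal_quot I}.
Let pi : {rmorphism G -> Q} := (\pi_Q)%qT.

Let piE a b : (pi a == pi b) = (a - b \in I).
Proof. by rewrite Quotient.idealrBE. Qed.
Let piK x : pi (repr x) = x. Proof. exact: reprK. Qed.

Let up (p : prime_idealr G) : {pred Q} := fun x => repr x \in p.
Let upE (p : prime_idealr G) a : (pi a \in up p) = (a \in p).
Proof.
have H : repr (pi a) - a \in p by apply: nilI; rewrite -piE piK.
rewrite -[LHS]/(repr (pi a) \in p); apply/idP/idP => ap.
  by rewrite -[a](subKr (repr (pi a))) rpredB.
by rewrite -[repr (pi a)](subrK a) rpredD.
Qed.

Let up_idealr (p : prime_idealr G) : idealr_closed (up p).
Proof.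
split=> [||a u v]; first by rewrite -(rmorph0 pi) upE rpred0.
  by rewrite -(rmorph1 pi) upE idealr1.
rewrite -[a]piK -[u]piK -[v]piK -rmorphM -rmorphD !upE => ur vr.
by rewrite rpredD // idealMr.
Qed.
Let up_prime (p : prime_idealr G) : prime_idealr_closed (up p).
Proof. by move=> u v; rewrite -[u]piK -[v]piK -rmorphM !upE prime_idealrM. Qed.

Let down (p : prime_idealr Q) : {pred G} := fun a => pi a \in p.
Let downE (p : prime_idealr Q) a : (a \in down p) = (pi a \in p). Proof. by []. Qed.
Let down_idealr (p : prime_idealr Q) : idealr_closed (down p).
Proof.
split=> [||a u v]; rewrite !downE ?rmorph0 ?rpred0 ?rmorph1 ?idealr1 // => uP vP.
by rewrite rmorphD rmorphM rpredD // idealMr.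
Qed.
Let down_prime (p : prime_idealr Q) : prime_idealr_closed (down p).
Proof. by move=> u v; rewrite !downE rmorphM prime_idealrM. Qed.

(** Every prime contains [I], so the primes of the quotient are those of the
    ring itself. *)
Lemma krull_dim_nil_quot d : krull_dim Q d <-> krull_dim G d.
Proof.
suff chainE n : prime_chain Q n <-> prime_chain G n.
  by split=> -[/chainE H1 H2]; split=> // n /chainE/H2.
split=> -[p pE].
  exists (fun i => prime_of (@down_idealr (p i)) (@down_prime (p i))) => i /pE[ij ji].
  split=> [a /ij //|H]; apply: ji => x; rewrite -[x]piK.
  exact: H.
exists (fun i => prime_of (@up_idealr (p i)) (@up_prime (p i))) => i /pE[ij ji].
split=> [a /ij //|H]; apply: ji => x xp.
by move: (H (pi x)); rewrite ![_ \in _]upE; apply.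
Qed.
End NilQuotient.

(** * Powers of the maximal ideal, completeness, minimal generators *)

Section Powers.
Variable k : fieldType.
Notation R := (pinch k).
Implicit Types r s : R.
Notation rmax := (rmax (k := k)).
Notation m := (rmax : idealr R).

Definition order_ge n : {pred R^o} := fun r => `[< forall d, (d < n)%N -> r d = 0 >].

Lemma order_ge_closed n : submod_closed (order_ge n).
Proof.
split=> [|a u v /asboolP un /asboolP vn]; apply/asboolP => // d dn.
rewrite -[a *: u + v]/((a * u : R) + v) pinchD planeD vn // addr0 pinchM planeM.
by apply: (@scoefM_lt _ 0 n).
Qed.

Lemma rmax_order r : r \in rmax -> forall d, (d < 2)%N -> r d = 0.
Proof. by move=> /rmaxP r0 [|[|//]] _ //; exact: pinch_coef1. Qed.

(** For [n > 0] the [n]-th power is the ideal [(x, y^2)^n] of the plane: a series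
    of order at least [2n + 4] is [y^2 a + x b] with [a] and [b] of order at
    least [2n + 2], and these orders force [a] and [b] into the pinched plane. *)
Lemma rmax_powP n r : r \in ideal_pow m n <-> forall d, (d < n.*2)%N -> r d = 0.
Proof.
split=> [|H].
  suff : {subset ideal_pow m n <= submod_of (order_ge_closed n.*2)}.
    by move=> H /H/asboolP.
  apply: span_sub => _ [u um <-]; apply/asboolP.
  elim: n u um => [|n IH] u um d; first by [].
  rewrite big_ord_recl doubleS => dn; rewrite pinchM planeM.
  apply: (@scoefM_lt _ 2 n.*2) => //; first exact/rmax_order/um.
  by apply: IH => i; exact: um.
elim: n r H => [|[|n] IH] r H; first exact: ideal_pow0.
  by apply: mem_ideal_pow1; apply/rmaxP; exact: H.
have [|w [h [rE _]]] := @plane_split _ (pinch_val r) n.+2.*2.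
  by move=> e en; rewrite H // coef0.
have [a aE] : exists a : R, pinch_val a = py k n.+1.*2 * w.
  by apply: pinch_of; rewrite py_coef doubleS.
have h0 d : (d < n.+1.*2)%N -> h d = 0.
  move=> dn; have : (px k * h) d.+2 = 0.
    rewrite (_ : px k * h = pinch_val r - py k n.+2.*2 * w); last by rewrite rE addrC addKr.
    by rewrite planeB H ?py_coef ?doubleS ?ltnS // leqNgt dn subr0.
  by rewrite px_coef /= subn2 => /eqP; rewrite mulf_eq0 polyX_eq0 => /eqP.
have [b bE] : exists b : R, pinch_val b = h by apply: pinch_of; exact: h0.
have -> : r = pinch_mono 2 1 * a + rx k * b.
  apply: pinch_inj; rewrite pinchD !pinchM rxE bE aE rE; congr (_ + _).
  apply: planeP => d; rewrite py_coef planeM pinch_monoE ?size_poly1 // smonoM mul1r.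
  rewrite py_coef doubleS; case: d => [|[|d]] //=; rewrite subn2 /= !ltnS.
  by rewrite subSS.
have m2 : pinch_mono 2 1 \in m.
  by apply/rmaxP; rewrite pinch_monoE ?size_poly1.
have mx : rx k \in m by apply/rmaxP; rewrite rxE pxE.
apply: idealD; apply: (ideal_powM (i := 1) (j := n.+1)).
- exact: mem_ideal_pow1.
- by apply: IH => d dn; rewrite aE py_coef leqNgt dn.
- exact: mem_ideal_pow1.
by apply: IH => d dn; rewrite bE h0.
Qed.

(** Modulo a power of the maximal ideal only finitely many coefficients matter,
    so a Cauchy sequence converges coefficientwise. *)
Lemma pinch_complete : adically_complete m.
Proof.
move=> u uC; have /choice[N NE] n : exists N, forall i j,
    (N <= i)%N -> (N <= j)%N -> forall d, (d < n.*2)%N -> u i d = u j d.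
  have [N NE] := uC n; exists N => i j Ni Nj d dn; apply/eqP; rewrite -subr_eq0.
  have /rmax_powP/(_ d dn) := NE i j Ni Nj.
  by rewrite pinchB planeB => ->.
have [f fE] : exists f : plane k, plane_val f = Powser (fun d => u (N d.+1) d).
  by apply: plane_of => d; exact: plane_size.
have [l lE] : exists l : R, pinch_val l = f.
  by apply: pinch_of; rewrite fE /= pinch_coef1.
have lim n i d : (N n <= i)%N -> (d < n.*2)%N -> u i d = l d.
  move=> ni dn; rewrite lE fE /=.
  rewrite (NE n i (maxn i (N d.+1)) ni _ d dn); last by rewrite (leq_trans ni) ?leq_maxl.
  by apply: (NE d.+1); rewrite ?leq_maxr // doubleS; lia.
exists l; split=> [n|l' l'lim].
  exists (N n) => i ni; apply/rmax_powP => d dn.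
  by rewrite pinchB planeB (lim n) // subrr.
apply: pinch_inj; apply: planeP => d.
have [M ME] := l'lim d.+1; pose i := maxn M (N d.+1).
have dd : (d < d.+1.*2)%N by rewrite doubleS; lia.
rewrite -(lim d.+1 i d) ?leq_maxr //.
have /rmax_powP/(_ d dd) := ME i (leq_maxl _ _).
by rewrite pinchB planeB => /subr0_eq.
Qed.

(** The elements [x], [xy], [y^2] and [y^3]. *)
Definition tangent_gens : seq R :=
  [:: rx k; pinch_mono 3 'X; pinch_mono 2 1; pinch_mono 3 1].

Lemma tangent_gens_sub r : r \in tangent_gens -> r \in m.
Proof.
have mono e (p : {poly k}) : (size p <= e./2.+1)%N -> (1 < e)%N -> pinch_mono e p \in m.
  by case: e => [|[|e]] // sp _; apply/rmaxP; rewrite pinch_monoE.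
by rewrite !inE => /or4P[]/eqP->; apply: mono => //=;
  rewrite ?size_polyX ?size_poly1.
Qed.

Lemma tangent_gens_generate r : r \in m -> r \in ispan [set` tangent_gens].
Proof.
move=> rm.
have [|w [h [rE _]]] := @plane_split _ (pinch_val r) 2.
  by move=> e e2; rewrite rmax_order // coef0.
have dec (f : plane k) : exists (a : R) (c : k), f = pinch_val a + pinch_val (rconst c) * py k 1.
  have f1 : f 1 = ((f 1)`_0)%:P by apply: size1_polyC; exact: (plane_size f 1).
  have cE : (pinch_val (rconst (f 1)`_0) * py k 1) 1 = f 1.
    by rewrite mulrC py_coef subnn pinch_monoE ?size_polyC_leq1 //= -f1.
  have [|a aE] := @pinch_of _ (f - pinch_val (rconst (f 1)`_0) * py k 1).
    by rewrite planeB cE subrr.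
  by exists a, (f 1)`_0; rewrite aE subrK.
have [a [c wE]] := dec w; have [b [c' hE]] := dec h.
have -> : r = a * pinch_mono 2 1 + rconst c * pinch_mono 3 1 +
              b * rx k + rconst c' * pinch_mono 3 'X.
  have y2 : pinch_val (pinch_mono 2 1) = py k 2.
    by apply: plane_inj; rewrite pinch_monoE ?size_poly1 ?pyE.
  have y3 : pinch_val (pinch_mono 3 1) = py k 2 * py k 1.
    apply: planeP => e; rewrite pinch_monoE ?size_poly1 // py_coef pyE /=.
    by case: e => [|[|e]] //; rewrite subn2.
  have xy : pinch_val (pinch_mono 3 'X) = px k * py k 1.
    apply: planeP => e; rewrite pinch_monoE ?size_polyX // px_coef pyE /=.
    case: e => [|[|e]] //; rewrite subn2 /= !eqSS.
    by case: eqP => _; rewrite ?mulr1 ?mulr0.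
  apply: pinch_inj; rewrite !pinchD !pinchM y2 y3 xy rxE rE wE hE.
  by ring.
have sp c0 g : g \in tangent_gens -> c0 * g \in ispan [set` tangent_gens].
  by move=> gt; apply: (@idealM _ (Defs.span _)); apply: mem_span.
do 3?apply: (@idealD _ (Defs.span _)); apply: sp; by rewrite !inE eqxx ?orbT.
Qed.

(** For [j = 0, 1, 2, 3], the coefficients of [x = u s^2], [xy = u s^3], [y^2]
    and [y^3], which are coordinates on [m/m^2]. *)
Definition tangent_coord (j : 'I_4) r : k := (r (2 + odd j)%N)`_(j < 2)%N.

(** The coefficients of [x], [xy], [y^2], [y^3] are linear over the residue field
    on the maximal ideal, so expressing these four elements in [n] generators
    factors the identity matrix of size 4 through dimension [n]. *)
Lemma pinch_min_gens : min_gens (V := R^o) m 4.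
Proof.
split.
  exists (tnth (in_tuple tangent_gens)) => r; rewrite (range_tnth tangent_gens); apply/idP/idP.
    exact: tangent_gens_generate.
  have H : submod_closed (m : {pred R^o}).
    by split=> [|a u v um vm]; rewrite ?rpred0 // rpredD // idealMr.
  by apply: (@span_sub _ _ (submod_of H)) => a /tangent_gens_sub.
move=> n g gm.
have gin i : g i \in m by rewrite gm; apply: mem_span; exists i.
have coordM (a r : R) (j : 'I_4) : r \in m ->
    tangent_coord j (a * r) = (a 0)`_0 * tangent_coord j r.
  move=> rm; have /rmax_order r0 := rm.
  have H d : (2 <= d < 4)%N -> (a * r : R) d = a 0 * r d.
    move=> /andP[d2 d4]; rewrite pinchM planeM.
    case: d d2 d4 => [|[|[|[|d]]]] // _ _.
      rewrite scoefM !big_ord_recl big_ord0 /= /bump /= !add1n !subSS !subn0.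
      by rewrite (r0 1) // (r0 0) // !mulr0 !addr0.
    rewrite scoefM !big_ord_recl big_ord0 /= /bump /= !add1n !subSS !subn0.
    by rewrite pinch_coef1 (r0 1) // (r0 0) // !mulr0 mul0r !addr0.
  rewrite /tangent_coord H; last by case: (odd j).
  by rewrite {1}(size1_polyC (plane_size a 0)) coefCM.
pose e (i : 'I_4) : R := nth 0 tangent_gens i.
have em i : e i \in m by apply: tangent_gens_sub; exact: mem_nth.
have /choice[c cE] i : exists a : 'I_n -> R, e i = \sum_l a l * g l.
  by apply/span_rangeP; rewrite -gm.
apply: (@mulmx1_min k 4 n (\matrix_(i, l) (c i l 0)`_0) (\matrix_(l, j) tangent_coord j (g l))).
apply/matrixP => i j; rewrite !mxE.
have coord_sum (F : 'I_n -> R) : tangent_coord j (\sum_l F l) = \sum_l tangent_coord j (F l).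
  rewrite /tangent_coord; elim/big_rec2: _ => [|l a b _ <-]; first by rewrite plane0 coef0.
  by rewrite pinchD planeD coefD.
transitivity (tangent_coord j (e i)).
  by rewrite cE coord_sum; apply: eq_bigr => l _; rewrite !mxE coordM.
rewrite /tangent_coord /e.
by case: i => -[|[|[|[|//]]]] Hi; case: j {coord_sum} => -[|[|[|[|//]]]] Hj /=;
  rewrite ?rxE ?pxE ?pinch_monoE ?size_polyX ?size_poly1 //= ?coefX ?coef1 ?coef0.
Qed.
End Powers.

(** * Lengths *)

(** A filtration with cyclic one-step quotients having no proper nonzero
    submodule is a composition series: along any strict chain [N], the number
    of steps of the filtration met by [N i] increases strictly with [i]. *)
Lemma has_length_filtration (R : pzRingType) (V : lmodType R)
    (W : nat -> submodClosed V) L :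
    (forall v, v \in W 0) -> (forall v, v \in W L -> v = 0) ->
    (forall t, (t < L)%N -> psubset (W t.+1) (W t)) ->
    (forall t v w, (t < L)%N -> v \in W t -> w \in W t -> w \notin W t.+1 ->
       exists c, v - c *: w \in W t.+1) ->
  has_length V L.
Proof.
move=> W0 WL Wstep Wsimple; split.
  exists (fun i => W (L - i)%N) => i iL; have := Wstep (L - i.+1)%N.
  by rewrite subnSK //; apply; lia.
move=> n [N NE].
pose b i t := `[< exists v, [/\ v \in N i, v \in W t & v \notin W t.+1] >].
pose D i := (\sum_(t < L) b i t)%N.
have bS i t : (i < n)%N -> b i t -> b i.+1 t.
  by move=> /NE[NN _] /asboolP[v [vN v1 v2]]; apply/asboolP; exists v; rewrite NN.
have DS i : (i < n)%N -> (D i < D i.+1)%N.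
  move=> il; rewrite ltnNge; apply/negP => DD.
  have bE (t : 'I_L) : b i.+1 t -> b i t.
    apply: contraTT => nb; apply/negP => bt; move: DD; apply/negP; rewrite -ltnNge.
    rewrite /D (bigD1 t) //= [X in (_ < X)%N](bigD1 t) //= (negPf nb) bt add0n add1n ltnS.
    by apply: leq_sum => j _; case: (b i j) (bS i j il) => //= ->.
  have [_ []] := NE i il.
  suff H j : (j <= L)%N -> forall v, v \in N i.+1 -> v \in W (L - j)%N -> v \in N i.
    by move=> v vN; apply: (H L) => //; rewrite subnn.
  elim: j => [|j IH] jL v vN vW.
    by rewrite subn0 in vW; rewrite (WL v vW) (@rpred0 _ (N i)).
  have tL : (L - j.+1 < L)%N by lia.
  have WS : (L - j.+1).+1 = (L - j)%N by rewrite subnSK.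
  have [vS|vS] := boolP (v \in W (L - j.+1).+1).
    by apply: IH; rewrite -?WS //; exact: ltnW.
  have /asboolP[w [wN wW wS]] : b i (Ordinal tL) by apply: bE; apply/asboolP; exists v.
  have [c cE] := Wsimple _ v w tL vW wW wS.
  rewrite -[v](subrK (c *: w)); apply: (@rpredD _ (N i)); last exact: (@rpredZ _ _ (N i)).
  apply: IH; [exact: ltnW| |by rewrite -WS].
  rewrite -scaleNr; apply: (@rpredD _ (N i.+1)) => //; apply: (@rpredZ _ _ (N i.+1)).
  by have [NN _] := NE i il; exact: NN.
have Dn i : (i <= n)%N -> (i <= D i)%N.
  elim: i => // i IH il; exact: leq_ltn_trans (IH (ltnW il)) (DS i il).
apply: leq_trans (Dn n (leqnn n)) _.
rewrite -[X in (_ <= X)%N]card_ord -sum1_card; apply: leq_sum => t _.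
by case: (b n t).
Qed.

Section QuotientLength.
Variables (R : comNzRingType) (N : submodClosed R^o) (W : nat -> submodClosed R^o).
Variable L : nat.
Hypotheses (W0 : forall v, v \in W 0) (WL : W L =i N)
  (Wstep : forall t, (t < L)%N -> psubset (W t.+1) (W t))
  (Wsimple : forall t v w, (t < L)%N -> v \in W t -> w \in W t -> w \notin W t.+1 ->
       exists c, v - c * w \in W t.+1).

Let NW t : (t <= L)%N -> {subset N <= W t}.
Proof.
move=> tL; rewrite -(subKn tL); move: (L - t)%N (leq_subr t L) => j.
elim: j => [|j IH] jL v vN; first by rewrite subn0 WL.
have tL' : (L - j.+1 < L)%N by lia.
have [sub _] := Wstep tL'; apply: sub.
by rewrite subnSK //; apply: IH => //; exact: ltnW.
Qed.

Let V t : {pred quot_module N} := fun x => quot_repr x \in W (minn t L).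

Let VE t (v : R^o) : (quot_proj N v \in V t) = (v \in W (minn t L)).
Proof.
have H : quot_repr (quot_proj N v) - v \in W (minn t L).
  by apply: (NW (geq_minr _ _)); rewrite -quot_projE quot_reprK.
rewrite -[LHS]/(quot_repr _ \in W _); apply/idP/idP => vW.
  by rewrite -[v](subKr (quot_repr (quot_proj N v))); apply: idealB.
by rewrite -[quot_repr _](subrK v); apply: idealD.
Qed.

Let proj0 : quot_proj N 0 = 0.
Proof. by apply: (addrI (quot_proj N 0)); rewrite -quot_projD !addr0. Qed.

Let V_closed t : submod_closed (V t).
Proof.
split=> [|a x y]; first by rewrite -proj0 VE; exact: ideal0.
rewrite -[x]quot_reprK -[y]quot_reprK.
rewrite -[a *: _]/(quot_scale _ _) quot_scaleE -quot_projD !VE => xW yW.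
by apply: idealD => //; apply: idealM.
Qed.

(** The same criterion for a quotient of the ring, with a filtration upstairs. *)
Lemma has_length_quot : has_length (quot_module N) L.
Proof.
have WE t (v : R^o) : (quot_proj N v \in submod_of (V_closed t)) = (v \in W (minn t L)).
  exact: VE.
apply: (has_length_filtration (W := fun t => submod_of (V_closed t))).
- by move=> x; rewrite -[x]quot_reprK WE min0n.
- move=> x; rewrite -[x]quot_reprK WE minnn WL => xN.
  by rewrite -proj0; apply/eqP; rewrite quot_projE subr0.
- move=> t tL; have [st ts] := Wstep tL; split=> [x|H].
    by rewrite -[x]quot_reprK !WE (minn_idPl tL) (minn_idPl (ltnW tL)); exact: st.
  apply: ts => v vW; have := H (quot_proj N v).
  by rewrite !WE (minn_idPl tL) (minn_idPl (ltnW tL)); apply.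
move=> t x y tL; rewrite -[x]quot_reprK -[y]quot_reprK !WE.
rewrite (minn_idPl tL) (minn_idPl (ltnW tL)) => xW yW yS.
have [c cE] := Wsimple tL xW yW yS; exists c.
rewrite -[c *: _]/(quot_scale _ _) quot_scaleE -scaleN1r.
rewrite -[-1 *: _]/(quot_scale _ _) quot_scaleE -quot_projD WE (minn_idPl tL).
by rewrite scaleN1r.
Qed.
End QuotientLength.

Section PinchLength.
Variable k : fieldType.
Notation R := (pinch k).
Notation rmax := (rmax (k := k)).
Notation m := (rmax : idealr R).
Implicit Types r s : R.

(** The dimension over [k] of the component of degree [d] of the pinched plane,
    for the grading in which [y] has degree 1 and [x] degree 2. *)
Definition gdim (d : nat) : nat := if d == 1%N then 0%N else d./2.+1.
Definition gdim_below (d : nat) : nat := (\sum_(e < d) gdim e)%N.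

Lemma gdim_belowS d : gdim_below d.+1 = (gdim_below d + gdim d)%N.
Proof. exact: big_ord_recr. Qed.

Lemma gdim_below_mono d e : (d <= e)%N -> (gdim_below d <= gdim_below e)%N.
Proof.
move=> de; rewrite -(subnKC de); elim: (e - d)%N => [|n IH]; first by rewrite addn0.
by rewrite addnS gdim_belowS (leq_trans IH) // leq_addr.
Qed.

(** For [j > 0] this is one less than the colength of [(x, y^2)^j] in the plane,
    the missing monomial being [y]. *)
Lemma gdim_belowE j : gdim_below j.*2 = (j * j.+1).-1.
Proof.
have H i : gdim_below i.+1.*2 = (i.+1 * i.+2).-1.
  elim: i => [|i IH]; first by rewrite /gdim_below !big_ord_recl big_ord0.
  rewrite doubleS 2!gdim_belowS IH /gdim /= doubleK uphalf_double; lia.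
by case: j => [|j]; [rewrite /gdim_below big_ord0|exact: H].
Qed.

Lemma gdim_position D t : (t < gdim_below D)%N ->
  exists d i, [/\ (d < D)%N, (i < gdim d)%N & t = (gdim_below d + i)%N].
Proof.
elim: D => [|D IH]; first by rewrite /gdim_below big_ord0.
rewrite gdim_belowS; case: (ltnP t (gdim_below D)) => [/IH[d [i [dD id ->]]] _|Dt tD].
  by exists d, i; rewrite ltnS ltnW.
by exists D, (t - gdim_below D)%N; rewrite ltnSn subnKC // -(ltn_add2l (gdim_below D)) subnKC.
Qed.

Lemma gdim_position_inj d i d' i' : (i < gdim d)%N -> (i' < gdim d')%N ->
  (gdim_below d + i = gdim_below d' + i')%N -> d = d' /\ i = i'.
Proof.
move=> id id' E; have [lt|gt|dd] := ltngtP d d'.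
- by have := gdim_below_mono lt; rewrite gdim_belowS; lia.
- by have := gdim_below_mono gt; rewrite gdim_belowS; lia.
by move: E; rewrite dd => /addnI.
Qed.

Lemma gdim_coef r d i : (gdim d <= i)%N -> (r d)`_i = 0.
Proof.
rewrite /gdim; case: eqP => [-> _|_ di]; first by rewrite pinch_coef1 coef0.
by rewrite nth_default // (leq_trans (plane_size r d)).
Qed.

(** The coefficients are enumerated by increasing degree [d] in [s], then by
    increasing exponent [i] of [u]; the coefficient of [u^i s^d] comes at position
    [gdim_below d + i]. *)
Definition coef_vanish t : {pred R^o} := fun r =>
  `[< forall d i, (i < gdim d)%N -> (gdim_below d + i < t)%N -> (r d)`_i = 0 >].

Lemma coef_vanish_low r t d : r \in coef_vanish t -> (gdim_below d.+1 <= t)%N -> r d = 0.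
Proof.
move=> /asboolP rt dt; apply/polyP => i; rewrite coef0.
have [id|/gdim_coef//] := ltnP i (gdim d).
by apply: rt => //; move: dt; rewrite gdim_belowS; lia.
Qed.

Lemma lead_coefM (a r : R) d : (forall e, (e < d)%N -> r e = 0) ->
  (a * r : R) d = ((a 0)`_0)%:P * r d.
Proof.
move=> r0; rewrite -(size1_polyC (plane_size a 0)) pinchM planeM.
have := @scoefM_shift _ 0 d 0 (plane_val a) (plane_val r).
by rewrite add0n addn0 big_ord1 addn0 => ->.
Qed.

Lemma coef_vanish_closed t : submod_closed (coef_vanish t).
Proof.
split=> [|a u v ut /asboolP vt]; apply/asboolP => d i id dt; first by rewrite coef0.
rewrite -[a *: u + v]/((a * u : R) + v) pinchD planeD coefD vt // addr0.
rewrite lead_coefM ?coefCM; last first.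
  move=> e ed; apply: (coef_vanish_low ut).
  by have := gdim_below_mono ed; lia.
by move/asboolP: ut => -> //; rewrite mulr0.
Qed.

Lemma pinch_length j : has_length (quot_module (ideal_pow m j)) (j * j.+1).-1.
Proof.
rewrite -gdim_belowE; pose W t := submod_of (coef_vanish_closed t).
have WP t (r : R^o) : reflect (forall d i, (i < gdim d)%N -> (gdim_below d + i < t)%N ->
  ((r : R) d)`_i = 0) (r \in W t) by exact: asboolP.
apply: (has_length_quot (W := W)).
- by move=> v; apply/WP.
- move=> v; apply/idP/idP => [vW|/rmax_powP vj]; last first.
    apply/WP => d i id dt; rewrite vj ?coef0 // ltnNge; apply/negP => /gdim_below_mono.
    by lia.
  by apply/rmax_powP => d dj; apply: (coef_vanish_low vW); exact: gdim_below_mono.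
- move=> t /gdim_position[d [i [dj id tE]]]; split=> [v /WP vt|H].
    by apply/WP => d' i' id' t'; apply: vt => //; exact: ltnW.
  pose w : R := pinch_mono d 'X^i.
  have wE : plane_val (pinch_val w) = smono d 'X^i.
    move: id; rewrite /gdim; case: eqP => // /eqP d1 id.
    by rewrite pinch_monoE // size_polyXn.
  have /WP/(_ d i id) : w \in W t.+1.
    apply: H; apply/WP => d' i' id' t'; rewrite wE /=; case: eqP => [dd|_]; last by rewrite coef0.
    by rewrite coefXn; case: eqP => // ii; move: t'; rewrite dd ii tE ltnn.
  rewrite wE /= eqxx coefXn eqxx tE ltnSn => /(_ isT)/eqP.
  by rewrite oner_eq0.
move=> t v w /gdim_position[d [i [dj id tE]]] vt wt wS.
have low u e : u \in W t -> (e < d)%N -> u e = 0.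
  by move=> ut ed; apply: (coef_vanish_low ut); have := gdim_below_mono ed; lia.
have wd : ((w : R) d)`_i != 0.
  apply: contraNneq wS => wd; apply/WP => d' i' id' t'.
  have [ltt|] := ltnP (gdim_below d' + i') t; first by move/WP: wt; apply.
  move=> tt; have [|-> -> //] := gdim_position_inj id' id.
  by lia.
exists (rconst ((v d)`_i / (w d)`_i)); apply/WP => d' i' id' t'.
rewrite pinchB planeB rconst_coef coefB coefCM.
have [ltt|tt] := ltnP (gdim_below d' + i') t.
  have /WP/(_ d' i' id' ltt) -> := wt.
  by have /WP/(_ d' i' id' ltt) -> := vt; rewrite mulr0 subr0.
have [|-> ->] := gdim_position_inj id' id; first by lia.
by rewrite divfK // subrr.
Qed.
End PinchLength.

(** * Multiplicity and the associated graded ring *)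

(** With [h = 1/(n+1)], the quotient at [n+1] is [2 + 2 h - 2 h^2]. *)
Lemma hs_limit (K : realType) :
  (fun j => (2`! * (j * j.+1).-1)%:R / j%:R ^+ 2 : K) @ \oo --> (2%:R : K).
Proof.
rewrite -cvg_shiftS.
rewrite (_ : [sequence _]_n =
    (fun n => 2 + 2 * harmonic n - 2 * (harmonic n * harmonic n))); last first.
  apply/funext => n; rewrite /harmonic /=.
  have -> : (2`! * (n.+1 * n.+2).-1)%:R = 2 * (n.+1%:R * (n.+1%:R + 1) - 1) :> K.
    rewrite (_ : 2`! = 2%N) // natrM; congr (_ * _).
    by rewrite natr1 -natrM -subn1 natrB.
  by field; rewrite nat1r pnatr_eq0.
have h : harmonic @ \oo --> (0 : K) by exact: cvg_harmonic.
suff : (fun n => 2 + 2 * harmonic n - 2 * (harmonic n * harmonic n) : K) @ \oo -->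
    (2 + 2 * 0 - 2 * (0 * 0) : K) by rewrite !mulr0 addr0 subr0.
apply: cvgB; last by apply: cvgMr; apply: cvgM.
by apply: cvgD; [exact: cvg_cst|exact: cvgMr].
Qed.

Section Graded.
Variable k : fieldType.
Notation R := (pinch k).
Notation rmax := (rmax (k := k)).
Notation m := (rmax : idealr R).
Implicit Types p q : rees m.

Lemma rees_order p i d : (d < i.*2)%N -> ((rees_val p)`_i : R) d = 0.
Proof. by have /asboolP/(_ i)/rmax_powP := valP p; apply. Qed.

(** The associated graded ring embeds into the dual numbers [f + g e] over
    [k[u][T]]: the class of [p] is sent to [f = symbol 0 p], [g = symbol 1 p]. *)
Definition symbol b p : {poly {poly k}} :=
  \poly_(i < size (rees_val p)) ((rees_val p)`_i : R) (i.*2 + b)%N.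

Lemma symbol_coef b p i : (symbol b p)`_i = ((rees_val p)`_i : R) (i.*2 + b)%N.
Proof. by rewrite coef_poly; case: ltnP => // ip; rewrite nth_default. Qed.

Lemma rees_coefM p q i : (rees_val (p * q))`_i =
  \sum_(j < i.+1) (rees_val p)`_j * (rees_val q)`_(i - j) :> R.
Proof. by rewrite reesM coefM. Qed.

Lemma pinch_sum_coef n (F : 'I_n -> R) d : (\sum_i F i : R) d = \sum_i F i d.
Proof. by elim/big_rec2: _ => // i _ a _ <-. Qed.

Lemma symbol0M p q : symbol 0 (p * q) = symbol 0 p * symbol 0 q.
Proof.
apply/polyP => i; rewrite symbol_coef rees_coefM coefM pinch_sum_coef.
apply: eq_bigr => -[j /= ji] _; rewrite !symbol_coef.
have := scoefM_shift 0 (@rees_order p j) (@rees_order q (i - j)).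
rewrite -doubleD subnKC // big_ord1 => H; apply: etrans H _.
by rewrite !addn0.
Qed.

Lemma symbol1M p q :
  symbol 1 (p * q) = symbol 0 p * symbol 1 q + symbol 1 p * symbol 0 q.
Proof.
apply/polyP => i; rewrite symbol_coef rees_coefM coefD !coefM pinch_sum_coef -big_split.
apply: eq_bigr => -[j /= ji] _; rewrite !symbol_coef.
have := scoefM_shift 1 (@rees_order p j) (@rees_order q (i - j)).
rewrite -doubleD subnKC // big_ord_recr big_ord1 /= => H; apply: etrans H _.
by rewrite !addn0.
Qed.

Lemma rees_shiftP p : p \in rees_shift (m := m) <-> symbol 0 p = 0 /\ symbol 1 p = 0.
Proof.
split=> [/asboolP H|[H0 H1]].
  split; apply/polyP => i; rewrite symbol_coef coef0;
    by have /rmax_powP := H i; apply; rewrite doubleS ?addn0 ?addn1.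
apply/asboolP => i; apply/rmax_powP => d; rewrite doubleS ltnS leq_eqVlt.
case/orP => [/eqP->|]; first by rewrite -addn1 -symbol_coef H1 coef0.
rewrite ltnS leq_eqVlt => /orP[/eqP->|]; last exact: rees_order.
by rewrite -[i.*2]addn0 -symbol_coef H0 coef0.
Qed.

Notation G := (assoc_graded m).
Notation pi := (\pi_(Quotient.quot (rees_shift (m := m))))%qT.

Lemma pi_eq0 p : (pi p == 0 :> G) = (p \in rees_shift (m := m)).
Proof. by rewrite -(rmorph0 pi) -Quotient.idealrBE subr0. Qed.

(** An associated prime consists of elements whose even symbol vanishes,
    because the even symbols form a domain acting without torsion; such
    elements have square zero. *)
Lemma associated_sub (P Q : prime_idealr G) : associated_prime P -> {subset P <= Q}.
Proof.
move=> [x xE] a; rewrite xE -[x]reprK -[a]reprK.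
set xi := repr x; set al := repr a; rewrite -rmorphM pi_eq0 => /rees_shiftP[].
rewrite symbol0M symbol1M => H0 H1.
have [a0|a0] := eqVneq (symbol 0 al) 0.
  have : pi al * pi al \in Q.
    suff -> : pi al * pi al = 0 by rewrite rpred0.
    apply/eqP; rewrite -rmorphM pi_eq0; apply/rees_shiftP.
    by rewrite symbol0M symbol1M a0 !mul0r mulr0 addr0.
  by rewrite prime_idealrM orbb.
have x0 : symbol 0 xi = 0.
  by apply/eqP; move/eqP: H0; rewrite mulf_eq0 (negPf a0).
have x1 : symbol 1 xi = 0.
  apply/eqP; move/eqP: H1; rewrite x0 mulr0 addr0.
  by rewrite mulf_eq0 (negPf a0).
have : 1 \in P.
  by rewrite xE mul1r -[x]reprK pi_eq0; apply/rees_shiftP.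
by rewrite idealr1.
Qed.

Lemma pinch_graded_unmixed : unmixed G.
Proof.
split; first exact/assoc_graded_noetherian/pinch_noetherian.
move=> P aP d; apply: krull_dim_nil_quot => Q; exact: associated_sub.
Qed.
End Graded.

Section ConstEmbedding.
Variable k : fieldType.

Lemma rconst_val (c : k) : plane_val (pinch_val (rconst c)) = smono 0 c%:P.
Proof. by rewrite pinch_monoE // size_polyC_leq1. Qed.

Fact rconst_zmod : zmod_morphism (@rconst k).
Proof.
move=> a b; apply: pinch_inj; apply: planeP => d.
rewrite pinchB planeB !rconst_val /=.
by case: eqP => _; rewrite ?polyCB ?subr0.
Qed.
Fact rconst_monoid : monoid_morphism (@rconst k).
Proof.
split=> [|a b]; apply: pinch_inj; apply: planeP => d.
  by rewrite rconst_val /=; case: d.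
by rewrite rconst_coef !rconst_val /=; case: eqP => _; rewrite ?polyCM ?mulr0.
Qed.
HB.instance Definition _ := GRing.isZmodMorphism.Build k (pinch k) (@rconst k) rconst_zmod.
HB.instance Definition _ := GRing.isMonoidMorphism.Build k (pinch k) (@rconst k) rconst_monoid.
End ConstEmbedding.

(** * The theorem *)

Theorem mainTheorem3 (K : realType) (k : fieldType) :
  exists (R : nat -> idomainType) (m : forall n, idealr (R n)),
  forall n : nat, (0 < n)%N ->
    [/\ noetherian (R n), local_ring (m n), krull_dim (R n) 2 &
        adically_complete (m n)] /\
    [/\ exists f : {rmorphism k -> R n}, injective f,
        min_gens (V := (R n)^o) (m n) 4 & hs_multiplicity (m n) (2%:R : K)] /\
    isolated_singularity (R n) /\ unmixed (assoc_graded (m n)).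
Proof.
exists (fun=> pinch k), (fun=> rmax (k := k) : idealr (pinch k)) => _ _.
split; first by split; [exact: pinch_noetherian|exact: pinch_local|exact: pinch_dim
  |exact: pinch_complete].
split; last by split; [exact: pinch_isolated|exact: pinch_graded_unmixed].
split; [|exact: pinch_min_gens|].
  by exists (@rconst k : {rmorphism _ -> _}); exact: fmorph_inj.
exists 2, (fun j => (j * j.+1).-1).
by split; [exact: pinch_dim|exact: pinch_length|exact: hs_limit].
Qed.
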